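(* Let $G$ be a finite abelian group, $\mathcal{T}$ a $G$ transfer system and $\mathcal{U}$ a $G$-universe. If $(\mathcal{T},\mathcal{T}_{\mathcal{D}(\mathcal{U})})$ is a compatible pair of transfer systems, then there exists an operad pair $(\mathcal{P},\mathcal{O})$ of $N_\infty$-operads with $\mathcal{T}_{\mathcal{P}}=\mathcal{T}$ and $\mathcal{T}_{\mathcal{O}}=\mathcal{T}_{\mathcal{D}(\mathcal{U})}$.
   Context: All groups are finite. A $G$ transfer system $\mathcal{T}$ is a partial order $\to_{\mathcal{T}}$ on the set of subgroups of $G$ such that: $K\to_{\mathcal{T}}H$ implies $K\le H$; if $L\to_{\mathcal{T}}H$ and $K\le H$ then $K\cap L\to_{\mathcal{T}}K$; if $K\to_{\mathcal{T}}H$ and $g\in G$ then $gKg^{-1}\to_{\mathcal{T}}gHg^{-1}$. A pair of $G$ transfer systems $(\mathcal{S},\mathcal{T})$ is compatible if, whenever $H\le G$ and $K,L\le H$ satisfy $K\to_{\mathcal{S}}H$ and $K\cap L\to_{\mathcal{T}}K$, then $L\to_{\mathcal{T}}H$. A $G$-universe $\mathcal{U}$ is a countably infinite-dimensional real orthogonal $G$-representation which contains a non-zero subrepresentation on which $G$ acts trivially, and such that for every finite-dimensional subrepresentation $V\subset\mathcal{U}$ and every $n$, $V^{\oplus n}$ embeds in $\mathcal{U}$. The transfer system $\mathcal{T}_{\mathcal{D}(\mathcal{U})}$ (associated with the infinite little discs operad over $\mathcal{U}$) is given, for $K\le H\le G$, by: $K\to_{\mathcal{D}(\mathcal{U})}H$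 iff the $H$-set $H/K$ embeds $H$-equivariantly into $\mathrm{res}^G_H\mathcal{U}$. A $G$-operad $\mathcal{O}$ consists of a $G\times\Sigma_n$-space $\mathcal{O}(n)$ for each $n\ge0$, a $G$-fixed identity $1\in\mathcal{O}(1)$, and $G$-equivariant composition maps $\gamma:\mathcal{O}(k)\times\mathcal{O}(n_1)\times\cdots\times\mathcal{O}(n_k)\to\mathcal{O}(n_1+\cdots+n_k)$, satisfying the usual unitality, associativity and permutation equivariance conditions. An $N_\infty$-operad is a $G$-operad $\mathcal{O}$ such that: each $\Sigma_n$-action on $\mathcal{O}(n)$ is free; for each $n$ there is a family $\mathcal{F}_n$ of subgroups of $G\times\Sigma_n$ (closed under conjugation and passage to subgroups), containing all $H\times\{e\}$ with $H\le G$, such that $\mathcal{O}(n)^\Gamma$ is contractible for $\Gamma\in\mathcal{F}_n$ and empty otherwise; and $\mathcal{O}(0)$ is $G$-contractible. The transfer system $\mathcal{T}_{\mathcal{O}}$ associated with an $N_\infty$-operad $\mathcal{O}$ is: $K\to_{\mathcal{O}}H$ iff $K\le H$ and, for $n=[H:K]$, $\mathcal{O}(n)^{\Gamma}\neq\emptyset$, where $\Gamma=\{(h,\sigma(h)):h\in H\}\le G\times\Sigma_n$ is the graph of a homomorphism $\sigma:H\to\Sigma_n$ classifying the $H$-set $H/K$. Two $G$-operads form an operad pair $(\mathcal{P},\mathcal{O})$ (in the sense of May) if there are $G$-equivariant continuous maps $\lambda:\mathcal{P}(k)\times\mathcal{O}(n_1)\times\cdots\times\mathcal{O}(n_k)\to\mathcal{O}(n_1\cdots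 n_k)$ for $k\ge0$, $n_r\ge0$, compatible with the operad structures as follows. (i) $\lambda(\gamma(g;g_1,\dots,g_k);(c_{r,q}))=\lambda(g;\lambda(g_1;c_{1,1},\dots,c_{1,j_1}),\dots,\lambda(g_k;c_{k,1},\dots,c_{k,j_k}))$ for $g\in\mathcal{P}(k)$, $g_r\in\mathcal{P}(j_r)$. (ii) For $g\in\mathcal{P}(k)$, $c_r\in\mathcal{O}(j_r)$ and $c_{r,q}\in\mathcal{O}(i_{r,q})$ with $1\le q\le j_r$: $\gamma(\lambda(g;c_1,\dots,c_k);(\lambda(g;c_{1,q_1},\dots,c_{k,q_k}))_{(q_1,\dots,q_k)})\,\nu=\lambda(g;\gamma(c_1;c_{1,1},\dots,c_{1,j_1}),\dots,\gamma(c_k;c_{k,1},\dots,c_{k,j_k}))$, where the sequences $(q_1,\dots,q_k)$, $1\le q_r\le j_r$, are ordered lexicographically and $\nu$ is the permutation given by the distributivity bijection $\prod_r\coprod_q\{1,\dots,i_{r,q}\}\cong\coprod_{(q_1,\dots,q_k)}\prod_r\{1,\dots,i_{r,q_r}\}$. (iii) $\lambda(1;c)=c$, and $\lambda(g;1,\dots,1)=1$ for $g\in\mathcal{P}(k)$, $k\ge0$. (iv) $\lambda(g\sigma;c_1,\dots,c_k)=\lambda(g;c_{\sigma^{-1}(1)},\dots,c_{\sigma^{-1}(k)})\,\sigma\langle j_1,\dots,j_k\rangle$ and $\lambda(g;c_1\tau_1,\dots,c_k\tau_k)=\lambda(g;c_1,\dots,c_k)(\tau_1\otimes\cdots\otimes\tau_k)$,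 where $\sigma\langle j_1,\dots,j_k\rangle$ is the permutation of $j_1\cdots j_k$ letters induced by permuting the factors of $\prod_r\{1,\dots,j_r\}$ by $\sigma$, and $\tau_1\otimes\cdots\otimes\tau_k$ is the product permutation (products being ordered lexicographically). *)

(* Defs.v *)
From HB Require Import structures.
From mathcomp Require Import all_boot all_order all_fingroup all_algebra.
From mathcomp Require Import sesquilinear.
From mathcomp Require Import boolp classical_sets functions set_interval.
From mathcomp Require Import reals topology.
From mathcomp Require Import normedtype.

Set Implicit Arguments.
Unset Strict Implicit.
Unset Printing Implicit Defensive.

Import Order.TTheory GRing.Theory Num.Theory.
Import numFieldNormedType.Exports.
Local Open Scope classical_set_scope.
Local Open Scope ring_scope.

Section TransferSystems.
Variable gT : finGroupType.
Implicit Types H K L : {group gT}.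

Definition transfer_system (T : {group gT} -> {group gT} -> Prop) : Prop :=
  [/\ [/\ forall H, T H H,
          forall H K, T H K -> T K H -> H = K
        & forall L K H, T L K -> T K H -> T L H],
      forall K H, T K H -> K \subset H,
      forall L H K, T L H -> K \subset H -> T (K :&: L)%G K
    & forall K H (g : gT), T K H -> T (K :^ g^-1)%G (H :^ g^-1)%G].

Definition compatible (S T : {group gT} -> {group gT} -> Prop) : Prop :=
  forall H K L, K \subset H -> L \subset H ->
    S K H -> T (K :&: L)%G K -> T L H.

End TransferSystems.

Section Universes.
Variables (R : realType) (gT : finGroupType).

Record orthRep := OrthRep {
  rep_space :> lmodType R;
  rep_dot : {dot rep_space for idfun};
  rep_act : gT -> {linear rep_space -> rep_space};
  rep_act1 : forall v, rep_act 1%g v = v;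
  rep_actM : forall g h v, rep_act (g * h)%g v = rep_act g (rep_act h v);
  rep_act_dot : forall g v w,
    rep_dot (rep_act g v) (rep_act g w) = rep_dot v w }.

Variable U : orthRep.

Definition subrep (V : set U) : Prop :=
  [/\ V 0, forall (a : R) v w, V v -> V w -> V (a *: v + w)
    & forall g v, V v -> V (rep_act U g v)].

Definition finite_dim (V : set U) : Prop :=
  exists m (b : 'I_m -> U), (forall i, V (b i)) /\
    forall v, V v -> exists c : 'I_m -> R, v = \sum_i c i *: b i.

Definition countably_infinite_dim : Prop :=
  exists e : nat -> U,
    (forall m (c : 'I_m -> R), \sum_i c i *: e i = 0 -> forall i, c i = 0) /\
    forall v, exists m (c : 'I_m -> R), v = \sum_i c i *: e i.

(* Only the restriction of f to the subspace V^n of U^n matters. *)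
Definition power_embeds (V : set U) (n : nat) : Prop :=
  exists f : {ffun 'I_n -> U} -> U,
    let Vn (v : {ffun 'I_n -> U}) := forall i, V (v i) in
    [/\ forall (a : R) v w, Vn v -> Vn w -> f (a *: v + w) = a *: f v + f w,
        forall g v, Vn v -> f [ffun i => rep_act U g (v i)] = rep_act U g (f v)
      & forall v w, Vn v -> Vn w -> f v = f w -> v = w].

Definition universe : Prop :=
  [/\ countably_infinite_dim,
      exists V : set U, [/\ subrep V, exists2 v, V v & v != 0
        & forall g v, V v -> rep_act U g v = v]
    & forall V : set U, subrep V -> finite_dim V ->
        forall n, power_embeds V n].

Definition discs_transfer (K H : {group gT}) : Prop :=
  K \subset H /\ exists f : {set gT} -> U,
    {in lcosets K H &, injective f} /\
    forall h A, h \in H -> A \in lcosets K H ->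
      f (h *: A)%g = rep_act U h (f A).

End Universes.

(* The library's [tagnat] identifies 'I_(\sum_r n r) with {r & 'I_(n r)} in
   lexicographic order. [prodnat] does the same for 'I_(\prod_r n r) and the
   sequences (q_r) with q_r : 'I_(n r), by mixed-radix expansion, the last
   component being the least significant digit. *)
Module prodnat.
Section prodnat.
Variables (k : nat) (n : 'I_k -> nat).

Definition weight (r : 'I_k) : nat := (\prod_(s < k | (r < s)%N) n s)%N.

Lemma prod_weight (m : nat) : (m <= k)%N ->
  forall q : forall r, 'I_(n r),
  (\sum_(r < k | (m <= r)%N) q r * weight r < \prod_(r < k | (m <= r)%N) n r)%N.
Proof.
move=> lemk q; rewrite -(subKn lemk); move: (k - m)%N (leq_subr m k) => d.
elim: d => [|d IHd] led.
  by rewrite subn0 !big_pred0 // => r; rewrite leqNgt ltn_ord.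
have ltk : (k - d.+1 < k)%N by rewrite ltn_subrL /= (leq_trans _ led).
pose r0 : 'I_k := Ordinal ltk.
have splitE (r : 'I_k) :
    ((k - d.+1 <= r) && (r != r0))%N = (k - d <= r)%N.
  rewrite -val_eqE /= eq_sym andbC -ltn_neqAle -subSn //.
rewrite (bigD1 r0) //= [X in (_ < X)%N](bigD1 r0) //=.
rewrite !(eq_bigl _ _ splitE).
have -> : weight r0 = (\prod_(r < k | (k - d <= r)%N) n r)%N.
  by apply: eq_bigl => r /=; rewrite -subSn.
have := IHd (ltnW led).
set S := (\sum_(_ < _ | _) _)%N; set W := (\prod_(_ < _ | _) _)%N => ltSW.
apply: (@leq_trans (q r0 * W + W)%N); first by rewrite ltn_add2l.
by rewrite -mulSnr leq_mul2r ltn_ord orbT.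
Qed.

Lemma rank_subproof (q : forall r, 'I_(n r)) :
  (\sum_(r < k) q r * weight r < \prod_(r < k) n r)%N.
Proof.
have := prod_weight (leq0n k) q.
by under eq_bigl do rewrite leq0n; under [X in (_ < X)%N]eq_bigl do rewrite leq0n.
Qed.

Definition rank (q : forall r, 'I_(n r)) : 'I_(\prod_(r < k) n r)%N :=
  Ordinal (rank_subproof q).

Lemma digit_subproof (p : 'I_(\prod_(r < k) n r)%N) (r : 'I_k) :
  (p %/ weight r %% n r < n r)%N.
Proof.
rewrite ltn_mod lt0n; apply/eqP => n0; case: p => p.
by rewrite (bigD1 r) //= n0 mul0n.
Qed.

Definition digits (p : 'I_(\prod_(r < k) n r)%N) (r : 'I_k) : 'I_(n r) :=
  Ordinal (digit_subproof p r).

Lemma rankK (q : forall r, 'I_(n r)) r : digits (rank q) r = q r.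
Proof.
apply: val_inj => /=.
rewrite (bigID (fun s : 'I_k => (s < r)%N)) /=.
rewrite [X in ((_ + X) %/ _)%N](eq_bigl (fun s : 'I_k => (r <= s)%N)); last first.
  by move=> s; rewrite -leqNgt.
rewrite [X in ((_ + X) %/ _)%N](bigD1 r) //=.
rewrite [X in ((_ + (_ + X)) %/ _)%N]
  (eq_bigl (fun s : 'I_k => (r.+1 <= s)%N)); last first.
  by move=> s; rewrite -val_eqE /= eq_sym andbC -ltn_neqAle.
have ltW := prod_weight (ltn_ord r) q; rewrite -/(weight r) in ltW.
have W0 : (0 < weight r)%N by apply: leq_trans ltW.
have /dvdnP[c ->] :
    (weight r * n r %| \sum_(s < k | (s < r)%N) q s * weight s)%N.
  elim/big_ind: _ => [|x y|s ltsr]; [exact: dvdn0 | exact: dvdn_add |].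
  apply: dvdn_mull; rewrite {2}/weight (bigID (fun t : 'I_k => (r <= t)%N)) /=.
  apply: dvdn_mulr; rewrite (bigD1 r) ?ltsr ?leqnn //= mulnC.
  rewrite (eq_bigl (fun t : 'I_k => (r < t)%N)) // => t.
  rewrite -val_eqE /= eq_sym -andbA [(_ && (_ != _))]andbC -ltn_neqAle.
  by rewrite andb_idl // => /(ltn_trans ltsr).
rewrite addnA [(weight r * _)%N]mulnC mulnA -mulnDl divnMDl //.
by rewrite (divn_small ltW) addn0 modnMDl modn_small.
Qed.

Lemma digitsK : cancel digits rank.
Proof.
pose f (q : {dffun forall r, 'I_(n r)}) := rank q.
have f_inj : injective f.
  move=> q q' eq_f; apply/ffunP => r; rewrite -(rankK q) -(rankK q').
  by rewrite -/(f q) eq_f.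
have cardE : #|{: {dffun forall r, 'I_(n r)}}| = #|'I_(\prod_(r < k) n r)%N|.
  rewrite card_ord card_dep_ffun foldrE big_map big_enum /=.
  by apply: eq_bigr => r _; rewrite card_ord.
have [g _ gK] := inj_card_bij f_inj (eq_leq (esym cardE)).
move=> p; rewrite -(gK p) {2}/f; congr rank.
by apply: functional_extensionality_dep => r; rewrite rankK.
Qed.

End prodnat.
End prodnat.

Lemma sum_sum_ord k (j : 'I_k -> nat) (i : forall r, 'I_(j r) -> nat) :
  (\sum_(p < \sum_(r < k) j r) i (tagnat.sig1 p) (tagnat.sig2 p) =
   \sum_(r < k) \sum_(q < j r) i r q)%N.
Proof.
rewrite sig_big_dep /=.
rewrite (reindex (@tagnat.sig _ j)) /=; last first.
  by exists tagnat.rank => p _; rewrite ?tagnat.sigK ?tagnat.rankK.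
by apply: eq_bigr => p _.
Qed.

Lemma prod_prod_ord k (j : 'I_k -> nat) (i : forall r, 'I_(j r) -> nat) :
  (\prod_(p < \sum_(r < k) j r) i (tagnat.sig1 p) (tagnat.sig2 p) =
   \prod_(r < k) \prod_(q < j r) i r q)%N.
Proof.
rewrite sig_big_dep /=.
rewrite (reindex (@tagnat.sig _ j)) /=; last first.
  by exists tagnat.rank => p _; rewrite ?tagnat.sigK ?tagnat.rankK.
by apply: eq_bigr => p _.
Qed.

Lemma sum1_ord n : (\sum_(r < n) 1 = n)%N.
Proof. by rewrite sum1_card card_ord. Qed.

Lemma prod1_ord n : (\prod_(r < n) 1 = 1)%N.
Proof. by rewrite big1. Qed.

Lemma tagged_ord_eq k (n : 'I_k -> nat) (x y : {r & 'I_(n r)}) :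
  tag x = tag y -> tagged x = tagged y :> nat -> x = y.
Proof.
case: x y => r q [r' q'] /= rr'; case: _ / rr' in q' *.
by move=> qq'; congr Tagged; apply: val_inj.
Qed.

Section OrdinalBijections.
Variable k : nat.

(* The permutation sigma(n_1, ..., n_k) of blocks: it sends the q-th letter of
   block r to the q-th letter of block sigma(r), which has n_r letters when the
   r-th block of the target has n_(sigma^-1(r)) letters. *)
Definition block_perm (s : 'S_k) (n : 'I_k -> nat)
    (p : 'I_(\sum_(r < k) n r)%N) : 'I_(\sum_(r < k) n (s^-1%g r))%N :=
  @tagnat.Rank k (fun r => n (s^-1%g r)) (s (tagnat.sig1 p))
    (cast_ord (congr1 n (esym (permK s (tagnat.sig1 p)))) (tagnat.sig2 p)).

Lemma block_perm_bij s n : bijective (@block_perm s n).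
Proof.
exists (fun p' => @tagnat.Rank k n (s^-1%g (tagnat.sig1 p')) (tagnat.sig2 p')).
  move=> p; rewrite -[RHS]tagnat.sigK [tagnat.sig p]tagnat.sigE12.
  congr tagnat.rank; apply: tagged_ord_eq => /=.
    by rewrite tagnat.Rank1K permK.
  by rewrite /block_perm tagnat.Rank2K cast_ord_comp.
move=> p; rewrite -[RHS]tagnat.sigK [tagnat.sig p]tagnat.sigE12.
congr tagnat.rank; apply: tagged_ord_eq => /=.
  by rewrite tagnat.Rank1K permKV.
by rewrite tagnat.Rank2K.
Qed.

Definition sum_perm (n : 'I_k -> nat) (t : forall r, 'S_(n r))
    (p : 'I_(\sum_(r < k) n r)%N) : 'I_(\sum_(r < k) n r)%N :=
  tagnat.Rank (tagnat.sig1 p) (t (tagnat.sig1 p) (tagnat.sig2 p)).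

Lemma sum_perm_bij n t : bijective (@sum_perm n t).
Proof.
apply: injF_bij => p p' /tagnat.rank_inj eqp.
rewrite -[p]tagnat.sigK -[p']tagnat.sigK; congr tagnat.rank.
move: eqp; rewrite /tagnat.sig2 /tagnat.sig1.
case: (tagnat.sig p) (tagnat.sig p') => r q [r' q'] /= eqp.
have rr' : r = r' by case: eqp.
case: _ / rr' in q' eqp *; congr Tagged; apply: (@perm_inj _ (t r)).
by move/eqP: eqp; rewrite eq_Tagged => /eqP.
Qed.

Definition factor_perm (s : 'S_k) (n : 'I_k -> nat)
    (p : 'I_(\prod_(r < k) n r)%N) : 'I_(\prod_(r < k) n (s^-1%g r))%N :=
  prodnat.rank (fun r => prodnat.digits p (s^-1%g r)).

Lemma factor_perm_bij s n : bijective (@factor_perm s n).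
Proof.
have cardE : (\prod_(r < k) n (s^-1%g r) = \prod_(r < k) n r)%N.
  by rewrite [RHS](reindex_inj (@perm_inj _ s^-1%g)).
apply: inj_card_bij; last by rewrite !card_ord cardE.
move=> p p' eqp.
rewrite -[p]prodnat.digitsK -[p']prodnat.digitsK; congr prodnat.rank.
apply: functional_extensionality_dep => r; rewrite -(permK s r).
by rewrite -(prodnat.rankK (fun r => prodnat.digits p (s^-1%g r)))
  -[LHS]/(prodnat.digits (factor_perm s p) _) eqp prodnat.rankK.
Qed.

Definition prod_perm (n : 'I_k -> nat) (t : forall r, 'S_(n r))
    (p : 'I_(\prod_(r < k) n r)%N) : 'I_(\prod_(r < k) n r)%N :=
  prodnat.rank (fun r => t r (prodnat.digits p r)).

Lemma prod_perm_bij n t : bijective (@prod_perm n t).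
Proof.
apply: injF_bij => p p' eqp.
rewrite -[p]prodnat.digitsK -[p']prodnat.digitsK; congr prodnat.rank.
apply: functional_extensionality_dep => r; apply: (@perm_inj _ (t r)).
by rewrite -(prodnat.rankK (fun r => t r (prodnat.digits p r)))
  -/(prod_perm t p) eqp prodnat.rankK.
Qed.

(* The distributivity bijection sends ((q_r, e_r))_r to ((q_r)_r, (e_r)_r). *)
Definition distr (j : 'I_k -> nat) (i : forall r, 'I_(j r) -> nat)
    (p : 'I_(\prod_(r < k) \sum_(q < j r) i r q)%N) :
    'I_(\sum_(Q < \prod_(r < k) j r) \prod_(r < k) i r (prodnat.digits Q r))%N :=
  let q r := tagnat.sig1 (prodnat.digits p r) in
  let e r := tagnat.sig2 (prodnat.digits p r) in
  @tagnat.Rank _ (fun Q => (\prod_(r < k) i r (prodnat.digits Q r))%N)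
    (prodnat.rank q)
    (prodnat.rank (fun r =>
       cast_ord (congr1 (i r) (esym (prodnat.rankK q r))) (e r))).

Lemma prodnat_rank_eq (n n' : 'I_k -> nat) (a : forall r, 'I_(n r))
    (b : forall r, 'I_(n' r)) :
  n =1 n' -> (forall r, a r = b r :> nat) ->
  prodnat.rank a = prodnat.rank b :> nat.
Proof.
move=> nn' ab; rewrite /= /prodnat.weight; apply: eq_bigr => r _.
by rewrite ab; congr muln; apply: eq_bigr => s _.
Qed.

Lemma prodnat_digits_eq (n n' : 'I_k -> nat) (p : 'I_(\prod_(r < k) n r)%N)
    (p' : 'I_(\prod_(r < k) n' r)%N) r :
  n =1 n' -> p = p' :> nat ->
  prodnat.digits p r = prodnat.digits p' r :> nat.
Proof.
move=> nn' pp'; rewrite /= /prodnat.weight pp' nn'; congr (_ %/ _ %% _)%N.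
by apply: eq_bigr => s _.
Qed.

Lemma distr_bij j i : bijective (@distr j i).
Proof.
pose inv (x : 'I_(\sum_(Q < \prod_(r < k) j r)
                   \prod_(r < k) i r (prodnat.digits Q r))%N) :=
  @prodnat.rank k (fun r => \sum_(q < j r) i r q)%N (fun r =>
    @tagnat.Rank _ (i r) (prodnat.digits (tagnat.sig1 x) r)
      (@prodnat.digits k (fun r => i r (prodnat.digits (tagnat.sig1 x) r))
        (tagnat.sig2 x) r)).
exists inv => [p|x].
  rewrite -[RHS]prodnat.digitsK; congr prodnat.rank.
  apply: functional_extensionality_dep => r.
  rewrite -[RHS]tagnat.sigK [tagnat.sig _]tagnat.sigE12.
  congr tagnat.rank; apply: tagged_ord_eq.
    by rewrite /= tagnat.Rank1K prodnat.rankK.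
  set p' := distr p.
  have E1 : tagnat.sig1 p' =
      prodnat.rank (fun r => tagnat.sig1 (prodnat.digits p r)).
    by rewrite tagnat.Rank1K.
  pose e' r := cast_ord (congr1 (i r) (esym (prodnat.rankK
      (fun r => tagnat.sig1 (prodnat.digits p r)) r)))
      (tagnat.sig2 (prodnat.digits p r)).
  have E2 : tagnat.sig2 p' = prodnat.rank e' :> nat.
    by rewrite tagnat.Rank2K.
  rewrite [LHS](prodnat_digits_eq r _ E2); last by move=> r'; rewrite E1.
  by rewrite [LHS](congr1 (@nat_of_ord _) (prodnat.rankK e' r)).
rewrite -[RHS]tagnat.sigK [tagnat.sig x]tagnat.sigE12.
have E r : prodnat.digits (inv x) r = _ := prodnat.rankK _ r.
have E1 r : tagnat.sig1 (prodnat.digits (inv x) r) =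
    prodnat.digits (tagnat.sig1 x) r by rewrite E tagnat.Rank1K.
have Q1 : prodnat.rank (fun r => tagnat.sig1 (prodnat.digits (inv x) r)) =
    tagnat.sig1 x.
  rewrite -[RHS]prodnat.digitsK; congr prodnat.rank.
  by apply: functional_extensionality_dep => r; rewrite E1.
congr tagnat.rank; apply: tagged_ord_eq => //.
rewrite -[in RHS](prodnat.digitsK (tagnat.sig2 x)).
apply: prodnat_rank_eq => r; first by rewrite prodnat.rankK E1.
rewrite -[LHS]/(val (tagnat.sig2 (prodnat.digits (inv x) r))).
by rewrite (congr1 (fun s => val (tagnat.sig2 s)) (E r)) tagnat.Rank2K.
Qed.

End OrdinalBijections.

(* Spaces are Hausdorff: without a separation axiom every nonempty set would
   carry a contractible topology. *)
Record symGspaces (gT : finGroupType) := SymGspaces {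
  sg_space :> nat -> topologicalType;
  sg_hausdorff : forall n, hausdorff_space (sg_space n);
  gact : forall n, gT -> sg_space n -> sg_space n;
  gact1 : forall n (x : sg_space n), gact 1%g x = x;
  gactM : forall n (g h : gT) (x : sg_space n),
    gact (g * h)%g x = gact g (gact h x);
  gact_continuous : forall n (g : gT), continuous (@gact n g);
  sact : forall n, sg_space n -> 'S_n -> sg_space n;
  sact1 : forall n (x : sg_space n), sact x 1%g = x;
  (* Right action for composition of functions: (t * s)%g is "t, then s". *)
  sactM : forall n (x : sg_space n) (s t : 'S_n),
    sact x (t * s)%g = sact (sact x s) t;
  sact_continuous : forall n (s : 'S_n), continuous (fun x => @sact n x s);
  gsactC : forall n (g : gT) (x : sg_space n) (s : 'S_n),
    gact g (sact x s) = sact (gact g x) s }.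

Section SymGspaces.
Variables (gT : finGroupType) (X : symGspaces gT).

Definition cast_arity m n (e : m = n) (x : X m) : X n := ecast i (X i) e x.

Lemma ord_bij_eq m n (f : 'I_n -> 'I_m) : bijective f -> m = n.
Proof. by move=> /bij_eq_card; rewrite !card_ord. Qed.

Lemma ord_bij_inj m n (f : 'I_n -> 'I_m) (fb : bijective f) :
  injective (cast_ord (ord_bij_eq fb) \o f).
Proof. exact: inj_comp (@cast_ord_inj _ _ _) (bij_inj fb). Qed.

(* x . f for a bijection f of letters; the sizes m and n are equal but need
   not be convertible. *)
Definition permute m n (f : 'I_n -> 'I_m) (fb : bijective f) (x : X m) : X n :=
  sact (cast_arity (ord_bij_eq fb) x) (perm (@ord_bij_inj _ _ f fb)).

(* Because of the order of multiplication in 'S_n, (g, s) |-> (x |-> g x s) is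
   an action of the library's group gT * 'S_n; it is the usual action
   (g, s) x = g x s^-1 of G x Sigma_n through (g, s) |-> (g, s^-1). *)
Definition fixed_points n (Gamma : {set gT * 'S_n}) : set (X n) :=
  [set x | forall g s, (g, s) \in Gamma -> gact g (sact x s) = x].

End SymGspaces.

Arguments fixed_points [gT] X [n] Gamma.

Record Goperad (gT : finGroupType) := GOperad {
  op_spaces :> symGspaces gT;
  op_one : op_spaces 1%N;
  op_comp : forall k (n : 'I_k -> nat),
    op_spaces k -> (forall r, op_spaces (n r)) ->
    op_spaces (\sum_(r < k) n r)%N;
  op_one_fixed : forall g : gT, gact g op_one = op_one;
  op_comp_gact : forall k (n : 'I_k -> nat) (g : gT) (x : op_spaces k)
      (y : forall r, op_spaces (n r)),
    gact g (op_comp x y) = op_comp (gact g x) (fun r => gact g (y r));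
  op_comp_continuous : forall k (n : 'I_k -> nat),
    continuous (fun z : op_spaces k * prod_topology (fun r => op_spaces (n r)) =>
      op_comp z.1 z.2);
  op_comp_one_l : forall n (x : op_spaces n),
    cast_arity (big_ord1 _ (fun _ => n)) (op_comp op_one (fun _ => x)) = x;
  op_comp_one_r : forall n (x : op_spaces n),
    cast_arity (sum1_ord n) (op_comp x (fun _ => op_one)) = x;
  op_compA : forall k (j : 'I_k -> nat) (i : forall r, 'I_(j r) -> nat)
      (x : op_spaces k) (y : forall r, op_spaces (j r))
      (z : forall r (q : 'I_(j r)), op_spaces (i r q)),
    cast_arity (sum_sum_ord i)
      (op_comp (op_comp x y)
        (fun p => z (tagnat.sig1 p) (tagnat.sig2 p))) =
    op_comp x (fun r => op_comp (y r) (z r));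
  op_comp_perm_l : forall k (n : 'I_k -> nat) (s : 'S_k) (x : op_spaces k)
      (y : forall r, op_spaces (n r)),
    op_comp (sact x s) y =
    permute (block_perm_bij s n) (op_comp x (fun r => y (s^-1%g r)));
  op_comp_perm_r : forall k (n : 'I_k -> nat) (t : forall r, 'S_(n r))
      (x : op_spaces k) (y : forall r, op_spaces (n r)),
    op_comp x (fun r => sact (y r) (t r)) =
    permute (sum_perm_bij t) (op_comp x y) }.

Record operad_pair (gT : finGroupType) (P O : Goperad gT) := OperadPair {
  lam : forall k (n : 'I_k -> nat),
    P k -> (forall r, O (n r)) -> O (\prod_(r < k) n r)%N;
  lam_gact : forall k (n : 'I_k -> nat) (h : gT) (g : P k)
      (c : forall r, O (n r)),
    gact h (lam g c) = lam (gact h g) (fun r => gact h (c r));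
  lam_continuous : forall k (n : 'I_k -> nat),
    continuous (fun z : P k * prod_topology (fun r => O (n r)) =>
      lam z.1 z.2);
  lam_comp_l : forall k (j : 'I_k -> nat) (n : forall r, 'I_(j r) -> nat)
      (g : P k) (g' : forall r, P (j r))
      (c : forall r (q : 'I_(j r)), O (n r q)),
    cast_arity (prod_prod_ord n)
      (lam (op_comp g g') (fun p => c (tagnat.sig1 p) (tagnat.sig2 p))) =
    lam g (fun r => lam (g' r) (c r));
  lam_distr : forall k (j : 'I_k -> nat) (i : forall r, 'I_(j r) -> nat)
      (g : P k) (c : forall r, O (j r))
      (d : forall r (q : 'I_(j r)), O (i r q)),
    permute (distr_bij i)
      (op_comp (lam g c) (fun Q => lam g (fun r => d r (prodnat.digits Q r)))) =
    lam g (fun r => op_comp (c r) (d r));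
  lam_one_l : forall n (c : O n),
    cast_arity (big_ord1 _ (fun _ => n)) (lam (op_one P) (fun _ => c)) = c;
  lam_one_r : forall k (g : P k),
    cast_arity (prod1_ord k) (lam g (fun _ => op_one O)) = op_one O;
  lam_perm_l : forall k (n : 'I_k -> nat) (s : 'S_k) (g : P k)
      (c : forall r, O (n r)),
    lam (sact g s) c =
    permute (factor_perm_bij s n) (lam g (fun r => c (s^-1%g r)));
  lam_perm_r : forall k (n : 'I_k -> nat) (t : forall r, 'S_(n r)) (g : P k)
      (c : forall r, O (n r)),
    lam g (fun r => sact (c r) (t r)) =
    permute (prod_perm_bij t) (lam g c) }.

Section Ninfty.
Variable R : realType.

Definition contractible (T : topologicalType) (A : set T) : Prop :=
  exists2 x0, A x0 & exists h : R * T -> T,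
    [/\ {within `[0, 1]%classic `*` A, continuous h},
        forall t x, 0 <= t <= 1 -> A x -> A (h (t, x)),
        forall x, A x -> h (0, x) = x
      & forall x, A x -> h (1, x) = x0].

Variable gT : finGroupType.

Definition G_contractible (T : topologicalType) (act : gT -> T -> T) : Prop :=
  exists2 x0, (forall g, act g x0 = x0) & exists h : R * T -> T,
    [/\ {within `[0, 1]%classic `*` setT, continuous h},
        forall g t x, 0 <= t <= 1 -> h (t, act g x) = act g (h (t, x)),
        forall x, h (0, x) = x
      & forall x, h (1, x) = x0].

Definition Ninfty_operad (O : Goperad gT) : Prop :=
  [/\ forall n (x : O n) (s : 'S_n), sact x s = x -> s = 1%g,
      forall n, exists F : {set {group gT * 'S_n}},
        [/\ forall Gamma a, Gamma \in F -> (Gamma :^ a)%G \in F,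
            forall Gamma Delta : {group gT * 'S_n},
              Gamma \in F -> Delta \subset Gamma -> Delta \in F,
            forall H : {group gT}, setX_group H 1%G \in F,
            forall Gamma, Gamma \in F -> contractible (fixed_points O Gamma)
          & forall Gamma, Gamma \notin F -> fixed_points O Gamma = set0]
    & G_contractible (@gact gT O 0)].

End Ninfty.

(* A homomorphism sigma : H -> Sigma_n classifying H/K is encoded by the
   morphism s h = sigma(h)^-1 into 'S_n, relative to a numbering b of the left
   cosets. *)
Definition operad_transfer (gT : finGroupType) (O : Goperad gT)
    (K H : {group gT}) : Prop :=
  K \subset H /\
  exists (s : {morphism H >-> 'S_(#|H : K|%g)}) (b : 'I_(#|H : K|%g) -> {set gT}),
    [/\ injective b, forall A, A \in lcosets K H <-> exists i, A = b i,
        forall h i, h \in H -> b (s h i) = (h^-1 *: b i)%g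
      & fixed_points O [set (h, s h) | h in H]%SET !=set0].

(* Main.v *)
From HB Require Import structures.
From mathcomp Require Import all_boot all_order all_fingroup all_algebra.
From mathcomp Require Import boolp classical_sets functions reals.
From mathcomp Require Import interval_inference topology normedtype lra.
Require Import Defs.

(* Choosing, for every u in U, its stabilizer gives a family I of subgroups
   which contains G and is closed under intersection, and K -> H for the little
   discs iff K = H :&: M with M in I. Let A be the countable G-set with
   infinitely many orbits G / M for each M in I.

   Take O(n) to be the injections n * A -> A, and P(n) to be the lenses
   A -> A^n, that is, the identifications of A with a product A^n * B: a lens
   acts on injections c_r by applying prod_r c_r to the coordinates in A^n and
   the identity to those in B, which satisfies the axioms of an operad pair on
   the nose. An H-equivariant lens A -> A^(H/K) exists as soon as the H-set
   A^(H/K) * A has its stabilizers among the H :&: M, since it is then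
   isomorphic to A by Cantor-Bernstein; for G abelian this is what
   compatibility says. To cut the transfers of P down to T, the n inputs of an
   element of P(n) are also labelled by pairwise diverging words, the first
   differing letters of two words being cosets x K, x K' with K, K' -> H and
   the same x H.

   All this is discrete. Replacing each set X by the space of right-constant
   step functions from [0, 1) to X, with the measure of {t | f t <> g t} as
   distance, preserves products and fixed points and makes every nonempty set
   contractible: overwrite f by a constant on [0, t). *)

Set Implicit Arguments.
Unset Strict Implicit.
Unset Printing Implicit Defensive.

Import Order.TTheory GRing.Theory Num.Theory.
Import numFieldNormedType.Exports.

(** * Step functions *)

Section StepFunctions.
Local Open Scope classical_set_scope.
Local Open Scope ring_scope.
Variable R : realType.
Implicit Types (t a b e : R) (A B : set R) (s : seq (R * R)).

Definition covers s A :=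
  forall t, A t -> exists2 p, p \in s & p.1 <= t < p.2.

(* The outer Jordan content of A is less than e. *)
Definition negligible_upto e A :=
  exists2 s, covers s A & \sum_(p <- s) `|p.2 - p.1| < e.

(** Induction on the number of intervals: drop one that contains [a]; the others still cover
    everything from its right end up to [b]. *)
Lemma covers_length s a b :
  covers s [set t | a <= t < b] -> b - a <= \sum_(p <- s) `|p.2 - p.1|.
Proof.
have [n le_s] := ubnP (size s); elim: n => // n IHn in s a le_s *.
have [le_ba _|lt_ab cov] := leP b a.
  by apply: (@le_trans _ _ 0); [rewrite subr_le0|exact: sumr_ge0].
have [|p ps /andP[le_pa lt_ap]] := cov a; first by rewrite /= lexx.
rewrite (big_rem p) //=.
have := IHn (rem p s) p.2; rewrite size_rem // => /(_ _ _) IH.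
have {}IH : b - p.2 <= \sum_(q <- rem p s) `|q.2 - q.1|.
  apply: IH => [|t /= /andP[le_pt lt_tb]].
    by rewrite -ltnS prednK //; case: (s) ps.
  have [|q qs qt] := cov t; first by rewrite /= lt_tb (le_trans (ltW lt_ap)).
  exists q => //; have := perm_to_rem ps => /perm_mem/(_ q).
  rewrite qs inE => /esym/orP[/eqP eq_qp|//].
  by move: qt; rewrite eq_qp ltNge le_pt andbF.
have := ler_norm (p.2 - p.1); lra.
Qed.

Lemma negligible_upto0 e : 0 < e -> negligible_upto e set0.
Proof. by move=> e0; exists [::]; rewrite ?big_nil. Qed.

Lemma negligible_uptoS e A B :
  A `<=` B -> negligible_upto e B -> negligible_upto e A.
Proof. by move=> AB [s cov lt]; exists s => // t /AB; exact: cov. Qed.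

Lemma negligible_uptoU e1 e2 A B : negligible_upto e1 A ->
  negligible_upto e2 B -> negligible_upto (e1 + e2) (A `|` B).
Proof.
move=> [s covA lt1] [s' covB lt2]; exists (s ++ s'); last first.
  by rewrite big_cat ltrD.
move=> t [/covA|/covB] [p ps pt]; exists p => //; rewrite mem_cat ps //.
exact: orbT.
Qed.

Lemma negligible_upto_bigU (I : finType) e (A : I -> set R) :
  0 < e -> (forall i, negligible_upto (e / #|I|.+1%:R) (A i)) ->
  negligible_upto e (\bigcup_i A i).
Proof.
move=> e0 negA.
(* The successor of [size r] leaves a positive bound for the empty list, since lengths are compared
   strictly; over the whole of [I] the factors cancel. *)
suff : forall r : seq I, negligible_upto (e / #|I|.+1%:R * (size r).+1%:R)
    [set t | exists2 i, i \in r & A i t].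
  move/(_ (enum I)); rewrite -cardE divfK ?pnatr_eq0 //.
  by apply: negligible_uptoS => t [i _ Ait]; exists i => //; rewrite mem_enum.
elim=> [|i r IHr].
  apply: (@negligible_uptoS _ _ set0); first by move=> t [].
  by apply: negligible_upto0; rewrite mulr_gt0 // divr_gt0.
rewrite /= -[_.+2%:R]natr1 mulrDr mulr1 addrC.
apply: negligible_uptoS (negligible_uptoU (negA i) IHr) => t [j].
by rewrite inE => /orP[/eqP->|jr] Ajt; [left|right; exists j].
Qed.

Lemma negligible_upto_itv e a b :
  negligible_upto e [set t | a <= t < b] -> b - a < e.
Proof. by case=> s /covers_length; exact: le_lt_trans. Qed.

Definition clamp t := if 0 <= t < 1 then t else 0.

Lemma clampE t : 0 <= t < 1 -> clamp t = t. Proof. by rewrite /clamp => ->. Qed.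

Lemma clamp_itv t : 0 <= clamp t < 1.
Proof. by rewrite /clamp; case: ifP => // _; rewrite lexx ltr01. Qed.

Lemma clampK t : clamp (clamp t) = clamp t.
Proof. exact/clampE/clamp_itv. Qed.

Lemma near_rightP t (P : R -> Prop) :
  (\forall u \near t^'+, P u) <->
  exists2 e, 0 < e & forall u, t < u < t + e -> P u.
Proof.
rewrite near_withinE; split=> [[e /= e0 eP]|[e e0 eP]].
  exists e => // u /andP[tu ut]; apply: eP => //=.
  by rewrite distrC ger0_norm; lra.
exists e => //= u /=; rewrite distrC => ut tu; apply: eP.
by rewrite tu -ltrBlDl (le_lt_trans (ler_norm _)).
Qed.

(* A locally right-constant function on [0, 1), extended to the rest of the line
   by its value at 0. *)
Record step (S : Type) := Step {
  step_fun :> R -> S;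
  step_clamp : forall t, step_fun (clamp t) = step_fun t;
  step_right : forall t, 0 <= t < 1 ->
    \forall s \near t^'+, step_fun s = step_fun t }.

(** [step_clamp] determines the values outside [0, 1), so agreement on [0, 1) is enough. *)
Lemma stepP S (f g : step S) : (forall t, 0 <= t < 1 -> f t = g t) -> f = g.
Proof.
case: f g => [f fc fr] [g gc gr] /= fg.
have {}fg : f = g by apply: funext => t; rewrite -fc -gc fg // clamp_itv.
by case: _ / fg in gc gr *; congr Step; exact: Prop_irrelevance.
Qed.

Definition step_cst S (x : S) : step S :=
  @Step S (fun=> x) (fun=> erefl) (fun t _ => nearW _ (fun=> erefl)).

Definition disagree S (f g : step S) : set R :=
  [set t | 0 <= t < 1 /\ f t <> g t].

Lemma disagreeC S (f g : step S) : disagree f g = disagree g f.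
Proof. by apply/seteqP; split=> t [t01 ne]; split=> // /esym. Qed.

HB.instance Definition _ S := gen_eqMixin (step S).
HB.instance Definition _ S := gen_choiceMixin (step S).

(** * The metric of disagreement *)

Section Topology.
Variable S : Type.

Definition step_ball (f : step S) e : set (step S) :=
  [set g | negligible_upto e (disagree f g)].

Lemma step_ball_center f e : 0 < e -> step_ball f e f.
Proof.
move=> e0; apply: negligible_uptoS (negligible_upto0 e0).
by move=> t [_]; exact.
Qed.

Lemma step_ball_sym f g e : step_ball f e g -> step_ball g e f.
Proof. by rewrite /step_ball /= disagreeC. Qed.

Lemma step_ball_triangle f g h e1 e2 :
  step_ball f e1 g -> step_ball g e2 h -> step_ball f (e1 + e2) h.
Proof.
move=> fg gh; apply: negligible_uptoS (negligible_uptoU fg gh).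
move=> t [t01 fht]; have [fgt|fgt] := pselect (f t = g t).
  by right; split=> //; rewrite -fgt.
by left.
Qed.

Definition step_ent : set_system (step S * step S) := entourage_ step_ball.

HB.instance Definition _ := hasNbhs.Build (step S) (nbhs_ step_ent).
HB.instance Definition _ := @Nbhs_isPseudoMetric.Build R (step S) step_ent erefl
  step_ball step_ball_center step_ball_sym step_ball_triangle erefl.

Lemma step_hausdorff : hausdorff_space (step S).
Proof.
rewrite ball_hausdorff => f g /eqP ne_fg.
have [t [t01 fgt]] : exists t, 0 <= t < 1 /\ f t <> g t.
  apply: contrapT => /forallNP fg; apply: ne_fg; apply: stepP => t t01.
  by apply: contrapT => fgt; apply: (fg t).
have [e e0 eP] : exists2 e, 0 < e &
    forall u, t < u < t + e -> f u <> g u /\ u < 1.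
  apply/near_rightP; case/andP: t01 => t0 t1; near=> u; split; last first.
    by near: u; exact: nbhs_right_lt.
  have -> : f u = f t by near: u; apply: step_right; rewrite t0.
  by have -> : g u = g t by near: u; apply: step_right; rewrite t0.
(* A common point of two balls of radius e / 4 would bound the content of the disagreement of [f]
   and [g] by e / 2, whereas it contains an interval of length 3e / 4. *)
have [d d_e] : exists d : {posnum R}, d%:num = e / 4.
  have e4 : 0 < e / 4 by lra.
  by exists (PosNum e4).
exists (d, d) => /=; rewrite d_e.
apply/eqP; rewrite -subset0 => h [fh hg].
have := step_ball_triangle fh (step_ball_sym hg).
move=> /(@negligible_uptoS _ [set u | t + e / 4 <= u < t + e] _) => H.
have /H/negligible_upto_itv : 
  [set u | t + e / 4 <= u < t + e] `<=` disagree f g; last by lra.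
move=> u /= /andP[tu ut]; have [|fgu u1] := eP u.
  by apply/andP; split; lra.
by split=> //; lra.
Unshelve. all: by end_near. Qed.

Lemma step_nbhsP (f : step S) (A : set (step S)) :
  nbhs f A <-> exists2 e, 0 < e & step_ball f e `<=` A.
Proof. by rewrite -nbhs_ballE; split=> -[e e0 eA]; exists e. Qed.

End Topology.

(** * Pointwise operations on step functions *)

Section Pointwise.
Variables (k : nat) (S0 S1 : Type) (S : 'I_k -> Type).
Variable F : S0 -> (forall r, S r) -> S1.

Lemma step_op_clamp (f : step S0) (g : forall r, step (S r)) t :
  F (f (clamp t)) (fun r => g r (clamp t)) = F (f t) (fun r => g r t).
Proof.
rewrite step_clamp; congr F.
by apply: functional_extensionality_dep => r; rewrite step_clamp.
Qed.

Lemma step_op_right (f : step S0) (g : forall r, step (S r)) t : 0 <= t < 1 ->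
  \forall u \near t^'+, F (f u) (fun r => g r u) = F (f t) (fun r => g r t).
Proof.
move=> t01; near=> u; have -> : f u = f t by near: u; exact: step_right.
congr F; apply: functional_extensionality_dep => r; move: r; near: u.
by apply: filter_forall => r; exact: step_right.
Unshelve. all: by end_near. Qed.

Definition step_op (f : step S0) (g : forall r, step (S r)) : step S1 :=
  Step (step_op_clamp f g) (@step_op_right f g).

(** The results can differ only where the first arguments or some components differ, so [F] may be
    arbitrary. Half of [e] goes to the first argument, half is shared among the finitely many
    components. *)
Lemma step_op_continuous :
  continuous (fun z : step S0 * prod_topology (fun r => step (S r)) =>
    step_op z.1 z.2).
Proof.
move=> [f g] A /step_nbhsP[e e0 eA] /=.
have e2 : 0 < e / 2 by lra.
have [d d0 le_d] : exists2 d, 0 < d & d = e / 2 / #|'I_k|.+1%:R.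
  by eexists; last reflexivity; rewrite divr_gt0.
have nearf : \forall f' \near f, step_ball f (e / 2) f'.
  by apply/step_nbhsP; exists (e / 2).
have nearg : \forall g' \near (g : prod_topology (fun r => step (S r))),
    forall r, step_ball (g r) d (g' r).
  apply: (@filter_forall _ _
      (fun r (g' : prod_topology (fun r => step (S r))) =>
        step_ball (g r) d (g' r))
      _ (nbhs_filter g)) => r.
  have H : forall V : set (step (S r)), nbhs (g r) V ->
      nbhs (g : prod_topology (fun r => step (S r))) [set h | V (h r)].
    exact: (@proj_continuous _ (fun r => step (S r)) r g).
  by apply: (H (step_ball (g r) d)); apply/step_nbhsP; exists d.
exists ([set f' | step_ball f (e / 2) f'],
        [set g' | forall r, step_ball (g r) d (g' r)]) => //.
case=> f' g' [/= ff' gg']; apply: eA; rewrite /step_ball /= [e]splitr.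
apply: negligible_uptoS (negligible_uptoU ff'
  (negligible_upto_bigU (A := fun r => disagree (g r) (g' r)) e2 _)).
  move=> t [t01 /= net]; have [fft|] := pselect (f t = f' t); last by left.
  right; apply: contrapT => noU; apply: net; rewrite fft; congr F.
  apply: functional_extensionality_dep => r; apply: contrapT => ner.
  by apply: noU; exists r.
by move=> r; rewrite -le_d; exact: gg'.
Qed.

End Pointwise.

Definition step_map S S' (F : S -> S') (f : step S) : step S' :=
  step_op (S := fun _ : 'I_0 => unit) (fun x _ => F x) f (fun=> step_cst tt).

Lemma step_map_continuous S S' (F : S -> S') : continuous (step_map F).
Proof.
move=> f A /step_nbhsP[e e0 eA]; apply/step_nbhsP; exists e => // g fg.
apply: eA; apply: negligible_uptoS fg => t [t01 /= ne]; split=> // fgt.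
by apply: ne; rewrite fgt.
Qed.

(** * Contraction to a constant function *)

Section Contraction.
Variables (S : Type) (x0 : S).

Definition step_contract_fun (z : R * step S) t : S :=
  if clamp t < z.1 then x0 else z.2 (clamp t).

Lemma step_contract_clamp z t :
  step_contract_fun z (clamp t) = step_contract_fun z t.
Proof. by rewrite /step_contract_fun clampK. Qed.

(** The overwritten part is open on the right, so just to the right of [t] the test against [z.1]
    has the same outcome as at [t]. *)
Lemma step_contract_right z t : 0 <= t < 1 ->
  \forall u \near t^'+, step_contract_fun z u = step_contract_fun z t.
Proof.
move=> t01; have /andP[t0 t1] := t01.
have clu : \forall u \near t^'+, clamp u = u.
  near=> u; apply/clampE/andP; split; last by near: u; exact: nbhs_right_lt.
  by apply: le_trans t0 _; near: u; exact: nbhs_right_ge.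
rewrite /step_contract_fun (clampE t01); have [ltz|lez] := ltP t z.1; near=> u.
  have -> : clamp u = u by near: u.
  by have -> : u < z.1 by near: u; exact: nbhs_right_lt.
have -> : clamp u = u by near: u.
have -> : (u < z.1) = false.
  apply/negbTE; rewrite -leNgt; apply: le_trans lez _.
  by near: u; exact: nbhs_right_ge.
by near: u; exact: step_right.
Unshelve. all: by end_near. Qed.

Definition step_contract z : step S :=
  Step (step_contract_clamp z) (@step_contract_right z).

Lemma step_contractE z t : 0 <= t < 1 ->
  step_contract z t = if t < z.1 then x0 else z.2 t.
Proof. by move=> t01; rewrite /= /step_contract_fun clampE. Qed.

Lemma step_contract0 f : step_contract (0, f) = f.
Proof.
apply: stepP => t t01; rewrite step_contractE //= ltNge.
by case/andP: t01 => ->.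
Qed.

Lemma step_contract1 f : step_contract (1, f) = step_cst x0.
Proof.
apply: stepP => t t01; rewrite step_contractE //=.
by case/andP: t01 => _ ->.
Qed.

(** The contractions of [f] at time a and of [g] at time b differ only between a and b or where [f]
    and [g] do. *)
Lemma step_contract_continuous : continuous step_contract.
Proof.
move=> [a f] A /step_nbhsP[e e0 eA] /=.
exists ([set b | `|a - b| < e / 2], [set g | step_ball f (e / 2) g]).
  split=> /=; last by apply/step_nbhsP; exists (e / 2) => //; lra.
  by exists (e / 2) => //=; lra.
case=> b g [/= ab fg]; apply: eA; rewrite /step_ball /= [e]splitr.
apply: (@negligible_uptoS _ _
  ([set t | Num.min a b <= t < Num.max a b] `|` disagree f g)).
  move=> t [t01]; rewrite !step_contractE //= => ne.
  have [fgt|fgt] := pselect (f t = g t); [left|by right].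
  rewrite ge_min lt_max; move: ne; rewrite fgt.
  by case: (ltP t a); case: (ltP t b); rewrite ?orbT.
apply: negligible_uptoU fg.
exists [:: (Num.min a b, Num.max a b)]; last first.
  rewrite big_seq1 /=; apply: le_lt_trans ab.
  rewrite maxr_absE minr_absE ler_norml; have := normr_ge0 (a - b).
  by move=> ?; apply/andP; split; lra.
by move=> t tab; exists (Num.min a b, Num.max a b); rewrite ?mem_seq1.
Qed.

End Contraction.
End StepFunctions.

(** * Operads of step functions *)

Section StepOperad.
Local Open Scope classical_set_scope.
Local Open Scope ring_scope.
Variables (R : realType) (gT : finGroupType).

Section StepSpaces.
Variable X : symGspaces gT.

Lemma step_gact1 n (f : step R (X n)) : step_map (gact 1%g) f = f.
Proof. by apply: stepP => t _; exact: gact1. Qed.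

Lemma step_gactM n (g h : gT) (f : step R (X n)) :
  step_map (gact (g * h)%g) f = step_map (gact g) (step_map (gact h) f).
Proof. by apply: stepP => t _; exact: gactM. Qed.

Lemma step_sact1 n (f : step R (X n)) : step_map (fun x => sact x 1%g) f = f.
Proof. by apply: stepP => t _; exact: sact1. Qed.

Lemma step_sactM n (f : step R (X n)) (s t : 'S_n) :
  step_map (fun x => sact x (t * s)%g) f =
  step_map (fun x => sact x t) (step_map (fun x => sact x s) f).
Proof. by apply: stepP => u _; exact: sactM. Qed.

Lemma step_gsactC n (g : gT) (f : step R (X n)) (s : 'S_n) :
  step_map (gact g) (step_map (fun x => sact x s) f) =
  step_map (fun x => sact x s) (step_map (gact g) f).
Proof. by apply: stepP => u _; exact: gsactC. Qed.

Definition step_spaces : symGspaces gT :=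
  @SymGspaces gT (fun n => step R (X n)) (fun n => @step_hausdorff R (X n))
    (fun n g => step_map (gact g)) step_gact1 step_gactM
    (fun n g => @step_map_continuous R _ _ (gact g))
    (fun n f s => step_map (fun x => sact x s) f) step_sact1 step_sactM
    (fun n s => @step_map_continuous R _ _ (fun x : X n => sact x s))
    step_gsactC.

Lemma step_castE m n (e : m = n) (f : step_spaces m) t :
  (cast_arity e f : step R (X n)) t = cast_arity e ((f : step R (X m)) t).
Proof. by case: _ / e. Qed.

Lemma step_permuteE m n (s : 'I_n -> 'I_m) (sb : bijective s)
    (f : step_spaces m) t :
  (permute sb f : step R (X n)) t = permute sb ((f : step R (X m)) t).
Proof. by rewrite /permute /= step_castE. Qed.

End StepSpaces.

Section StepGoperad.
Variable O : Goperad gT.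
Local Notation EO := (step_spaces O).

Definition step_comp k (n : 'I_k -> nat) (x : EO k) (y : forall r, EO (n r)) :
  EO (\sum_(r < k) n r)%N := step_op (fun a b => @op_comp gT O k n a b) x y.

Definition step_goperad : Goperad gT.
Proof.
apply: (@GOperad gT EO (step_cst R (op_one O)) step_comp).
- by move=> g; apply: stepP => t _; exact: op_one_fixed.
- by move=> *; apply: stepP => t _; exact: op_comp_gact.
- by move=> k n; exact: step_op_continuous.
- by move=> n x; apply: stepP => t _; rewrite step_castE; exact: op_comp_one_l.
- by move=> n x; apply: stepP => t _; rewrite step_castE; exact: op_comp_one_r.
- by move=> *; apply: stepP => t _; rewrite step_castE; exact: op_compA.
- move=> *; apply: stepP => t _; rewrite step_permuteE.
  exact: op_comp_perm_l.
- move=> *; apply: stepP => t _; rewrite step_permuteE.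
  exact: op_comp_perm_r.
Defined.

End StepGoperad.

Section StepPair.
Variables (P O : Goperad gT) (L : operad_pair P O).

Definition step_pair : operad_pair (step_goperad P) (step_goperad O).
Proof.
apply: (@OperadPair gT (step_goperad P) (step_goperad O)
  (fun k n x y => step_op (fun a b => @lam gT P O L k n a b) x y)).
- by move=> *; apply: stepP => t _; exact: lam_gact.
- by move=> k n; exact: step_op_continuous.
- by move=> *; apply: stepP => t _; rewrite step_castE; exact: lam_comp_l.
- by move=> *; apply: stepP => t _; rewrite step_permuteE; exact: lam_distr.
- by move=> *; apply: stepP => t _; rewrite step_castE; exact: lam_one_l.
- by move=> *; apply: stepP => t _; rewrite step_castE; exact: lam_one_r.
- by move=> *; apply: stepP => t _; rewrite step_permuteE; exact: lam_perm_l.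
- by move=> *; apply: stepP => t _; rewrite step_permuteE; exact: lam_perm_r.
Defined.

End StepPair.

Section StepNinfty.
Variable O : Goperad gT.

Lemma step_fixed_points n (Gamma : {set gT * 'S_n})
    (f : step R (O n)) :
  fixed_points (step_goperad O) Gamma f <->
  forall t, fixed_points O Gamma (f t).
Proof.
split=> [fixf t g s gs|fixf g s gs].
  exact: (congr1 (fun f : step R (O n) => f t) (fixf g s gs)).
by apply: stepP => t _; exact: fixf.
Qed.

(** Evaluate a fixed step function at 0, or take the constant function at a fixed point. Hence the
    step construction leaves the transfer system unchanged. *)
Lemma step_fixed_points_neq0 n (Gamma : {set gT * 'S_n}) :
  fixed_points (step_goperad O) Gamma !=set0 <-> fixed_points O Gamma !=set0.
Proof.
split=> [[f /step_fixed_points fixf]|[x fixx]]; first by exists (f 0).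
by exists (step_cst R x); apply/step_fixed_points => t; exact: fixx.
Qed.

Lemma step_operad_transfer (K H : {group gT}) :
  operad_transfer (step_goperad O) K H <-> operad_transfer O K H.
Proof.
by split=> -[sKH [s [b [binj bE sb fix0]]]]; split=> //; exists s, b;
  split=> //; apply/step_fixed_points_neq0.
Qed.

Lemma step_contract_fixed n (Gamma : {set gT * 'S_n}) (x0 : O n) :
  fixed_points O Gamma x0 ->
  @contractible R (step R (O n)) (fixed_points (step_goperad O) Gamma).
Proof.
move=> fix0; exists (step_cst R x0).
  by apply/step_fixed_points => t; exact: fix0.
exists (step_contract x0); split=> [|t f _ /step_fixed_points fixf|f _|f _].
- exact/continuous_subspaceT/step_contract_continuous.
- apply/step_fixed_points => u; rewrite /= /step_contract_fun.
  by case: ifP => // _; exact: fixf.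
- exact: step_contract0.
- exact: step_contract1.
Qed.

(** The family is that of all subgroups having a fixed point; contracting to such a point stays
    among the fixed points. A point fixed by the whole group puts each H * 1 in the family and
    contracts the space of arity 0 equivariantly. *)
Lemma step_Ninfty :
  (forall n (x : O n) (s : 'S_n), sact x s = x -> s = 1%g) ->
  (forall n, exists x : O n, forall g, gact g x = x) ->
  Ninfty_operad R (step_goperad O).
Proof.
move=> free fixG; split=> [n f s sf|n|].
- by apply: (free n (f 0)); exact: (congr1 (fun f : step R (O n) => f 0) sf).
- exists [set Gamma : {group gT * 'S_n} |
      `[< fixed_points O Gamma !=set0 >]]%SET.
  split=> [Gamma [g s]|Gamma Delta|H|Gamma|Gamma].
  + rewrite !inE => -[x fixx].
    (* Translating by the inverse of (g, s) takes fixed points of [Gamma] to fixed points of its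
       conjugate. *)
    exists (gact g^-1%g (sact x s^-1%g)) => _ _ /imsetP[[h t] /fixx E [-> ->]].
    rewrite -gsactC -gactM -sactM !mulgA !mulgK gactM sactM.
    by rewrite -[in RHS]E gsactC.
  + rewrite !inE => -[x fixx] sDG; exists x => g s gs.
    by apply: fixx; move/fintype.subsetP: sDG; exact.
  + rewrite inE; apply/asboolP; have [x fixx] := fixG n; exists x => g s.
    by rewrite finset.in_setX => /andP[_ /set1P->]; rewrite sact1 fixx.
  + by rewrite inE => /asboolP[x fixx]; exact: (step_contract_fixed fixx).
  + rewrite inE => /asboolP Gam0; apply/seteqP; split=> // f fixf; apply: Gam0.
    by apply/step_fixed_points_neq0; exists f.
have [x fixx] := fixG 0%N; exists (step_cst R x).
  by move=> g; apply: stepP => t _; exact: fixx.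
exists (step_contract x); split=> [|g t f _|f|f].
- exact/continuous_subspaceT/step_contract_continuous.
- apply: stepP => u u01 /=; rewrite /step_contract_fun /=.
  by case: ifP => // _; rewrite fixx.
- exact: step_contract0.
- exact: step_contract1.
Qed.

End StepNinfty.
End StepOperad.

(** * Lexicographic numberings *)

(** The second component has a type depending on the first; a function [F] of both absorbs the
    transport. *)
Lemma sig_Rank k (j : 'I_k -> nat) B (F : forall r, 'I_(j r) -> B) r q :
  F (tagnat.sig1 (tagnat.Rank r q)) (tagnat.sig2 (tagnat.Rank r q)) = F r q.
Proof.
exact: (congr1 (fun s : {r & 'I_(j r)} => F (tag s) (tagged s))
  (tagnat.rankK (Tagged (fun r => 'I_(j r)) q))).
Qed.

Lemma sig_cast k (j : 'I_k -> nat) B (F : forall r, 'I_(j r) -> B) r r'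
    (q : 'I_(j r)) (q' : 'I_(j r')) :
  r = r' -> q = q' :> nat -> F r q = F r' q'.
Proof. by move=> rr'; case: _ / rr' q' => q' qq'; congr F; exact: val_inj. Qed.

Lemma big_tagnat T (idx : T) (aop : Monoid.com_law idx)
    k (j : 'I_k -> nat) (C : pred 'I_(\sum_(r < k) j r)%N)
    (F : forall r, 'I_(j r) -> T) :
  \big[aop/idx]_(p | C p) F (tagnat.sig1 p) (tagnat.sig2 p) =
  \big[aop/idx]_r \big[aop/idx]_(q | C (tagnat.Rank r q)) F r q.
Proof.
rewrite sig_big_dep /= (reindex (@tagnat.sig _ j)) /=; last first.
  by exists tagnat.rank => p _; rewrite ?tagnat.sigK ?tagnat.rankK.
by apply: eq_bigl => p; rewrite tagnat.sig2K.
Qed.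

Lemma ltn_Rank k (j : 'I_k -> nat) r r' (q : 'I_(j r)) (q' : 'I_(j r')) :
  (tagnat.Rank r q < tagnat.Rank r' q')%N =
  (r < r')%N || (r == r') && (q < q')%N.
Proof.
pose Tj r (q : 'I_(j r)) := Tagged (fun r => 'I_(j r)) q.
transitivity (Tj r q < Tj r' q')%O; first by rewrite -tagnat.lt_rank ltEord.
rewrite ltEsig /= !leEord /= -val_eqE /=.
case: ltngtP => //= /val_inj rr'; case: _ / rr' q' => q'.
by rewrite tagged_asE ltEord.
Qed.

Lemma big_ltn_Rank T (idx : T) (aop : Monoid.com_law idx)
    k (j : 'I_k -> nat) (F : forall r, 'I_(j r) -> T) r (q : 'I_(j r)) :
  \big[aop/idx]_(p < (\sum_(r < k) j r)%N | (p < tagnat.Rank r q)%N)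
    F (tagnat.sig1 p) (tagnat.sig2 p) =
  aop (\big[aop/idx]_(r' < k | (r' < r)%N) \big[aop/idx]_q' F r' q')
    (\big[aop/idx]_(q' < j r | (q' < q)%N) F r q').
Proof.
rewrite big_tagnat (bigID (fun r' : 'I_k => (r' < r)%N)) /=; congr (aop _ _).
  apply: eq_bigr => r' lt_r'r; apply: eq_bigl => q'.
  by rewrite ltn_Rank lt_r'r.
rewrite (bigD1 r) ?ltnn //= [X in aop _ X]big1 => [|r' /andP[ge_r'r ne_r'r]].
  by rewrite Monoid.mulm1; apply: eq_bigl => q'; rewrite ltn_Rank ltnn eqxx.
rewrite big_pred0 // => q'.
by rewrite ltn_Rank (negbTE ge_r'r) (negbTE ne_r'r).
Qed.

Lemma big_gtn_Rank T (idx : T) (aop : Monoid.com_law idx)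
    k (j : 'I_k -> nat) (F : forall r, 'I_(j r) -> T) r (q : 'I_(j r)) :
  \big[aop/idx]_(p < (\sum_(r < k) j r)%N | (tagnat.Rank r q < p)%N)
    F (tagnat.sig1 p) (tagnat.sig2 p) =
  aop (\big[aop/idx]_(q' < j r | (q < q')%N) F r q')
    (\big[aop/idx]_(r' < k | (r < r')%N) \big[aop/idx]_q' F r' q').
Proof.
rewrite big_tagnat (bigID (fun r' : 'I_k => (r < r')%N)) /= Monoid.mulmC.
congr (aop _ _); last first.
  apply: eq_bigr => r' lt_rr'; apply: eq_bigl => q'.
  by rewrite ltn_Rank lt_rr'.
rewrite (bigD1 r) ?ltnn //= [X in aop _ X]big1 => [|r' /andP[ge_r'r ne_r'r]].
  by rewrite Monoid.mulm1; apply: eq_bigl => q'; rewrite ltn_Rank ltnn eqxx.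
rewrite big_pred0 // => q'.
by rewrite ltn_Rank (negbTE ge_r'r) eq_sym (negbTE ne_r'r).
Qed.

(** A position is the total size of the preceding blocks plus an offset. [big_ltn_Rank] splits this
    total for the flat numbering into the earlier outer blocks and the earlier inner blocks of the
    same outer block, as in the nested numbering. *)
Lemma sig_sum_sum_ord k (j : 'I_k -> nat) (i : forall r, 'I_(j r) -> nat) B
    (F : forall r q, 'I_(i r q) -> B)
    (p : 'I_(\sum_(r < k) \sum_(q < j r) i r q)%N) :
  let p' := cast_ord (esym (sum_sum_ord i)) p in
  F _ _ (tagnat.sig2 p') =
  F _ (tagnat.sig1 (tagnat.sig2 p)) (tagnat.sig2 (tagnat.sig2 p)).
Proof.
move=> p'; set P := tagnat.sig1 p'.
pose e : 'I_(i (tagnat.sig1 P) (tagnat.sig2 P)) := tagnat.sig2 p'.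
have pE : p = @tagnat.Rank _ (fun r => \sum_(q < j r) i r q)%N _
    (tagnat.Rank (tagnat.sig2 P) e).
  apply: val_inj; transitivity (val p') => //.
  rewrite [LHS](tagnat.rect p') [RHS]tagnat.RankEsum [in RHS]tagnat.RankEsum.
  rewrite addnA; congr (_ + _)%N; rewrite -/P -[in LHS](tagnat.sig2K P).
  by rewrite (big_ltn_Rank _ i).
pose G r (Q : 'I_(\sum_(q < j r) i r q)%N) :=
  F r (tagnat.sig1 Q) (tagnat.sig2 Q).
transitivity (G (tagnat.sig1 p) (tagnat.sig2 p)) => //.
by rewrite [in RHS]pE (sig_Rank G) /G (sig_Rank (F (tagnat.sig1 P))).
Qed.

(** Both sides are digits of one mixed-radix expansion: the flat weight of a digit is the product of
    the radices after it, and [big_gtn_Rank] factors it into the weight inside the block and the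
    weight of the block. *)
Lemma digits_prod_prod_ord k (j : 'I_k -> nat) (n : forall r, 'I_(j r) -> nat)
    (Q : 'I_(\prod_(r < k) \prod_(q < j r) n r q)%N) p :
  prodnat.digits (cast_ord (esym (prod_prod_ord n)) Q) p =
  prodnat.digits (prodnat.digits Q (tagnat.sig1 p)) (tagnat.sig2 p).
Proof.
pose d r q := prodnat.digits (prodnat.digits Q r) q.
suff -> : cast_ord (esym (prod_prod_ord n)) Q =
    prodnat.rank (fun p => d (tagnat.sig1 p) (tagnat.sig2 p)).
  by rewrite prodnat.rankK.
have rankE m (c : 'I_m -> nat) (a : forall r, 'I_(c r)) :
  prodnat.rank a = (\sum_r a r * prodnat.weight c r)%N :> nat by [].
apply: val_inj; rewrite [RHS]rankE -[LHS]/(val Q) -[in LHS](prodnat.digitsK Q).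
rewrite [LHS]rankE.
pose f r q := (d r q * prodnat.weight (n r) q *
  prodnat.weight (fun r => \prod_(q < j r) n r q)%N r)%N.
transitivity (\sum_r \sum_q f r q)%N.
  apply: eq_bigr => r _.
  by rewrite -[in LHS](prodnat.digitsK (prodnat.digits Q r)) rankE big_distrl.
rewrite -(big_tagnat _ xpredT f); apply: eq_bigr => P _.
rewrite /f -mulnA; congr (_ * _)%N; rewrite /prodnat.weight.
by rewrite -[in RHS](tagnat.sig2K P) (big_gtn_Rank _ n).
Qed.

Lemma sig2_big_ord1 n (p : 'I_(\sum_(r < 1) n)) :
  cast_ord (big_ord1 _ (fun=> n)) p = tagnat.sig2 p.
Proof.
apply: val_inj; rewrite /= [LHS]tagnat.rect big_pred0 // => i.
by rewrite ord1 [tagnat.sig1 p]ord1.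
Qed.

Lemma sig1_sum1_ord n (p : 'I_(\sum_(r < n) 1)) :
  cast_ord (sum1_ord n) p = tagnat.sig1 p.
Proof.
apply: val_inj; rewrite /= [LHS]tagnat.rect [tagnat.sig2 p]ord1 addn0.
by rewrite -(big_ord_widen n (fun=> 1%N)) ?sum1_ord // ltnW.
Qed.

(** * Injections and lenses *)

Section Families.
Variables (gT : finGroupType) (X : symGspaces gT).

Section Letters.
Variables (B : Type) (fam : forall n, X n -> 'I_n -> B).
Hypothesis fam_sact : forall n (x : X n) s i, fam (sact x s) i = fam x (s i).

Lemma fam_cast m n (e : m = n) (x : X m) i :
  fam (cast_arity e x) i = fam x (cast_ord (esym e) i).
Proof. by case: _ / e i => i; rewrite cast_ord_id. Qed.

(** Reading an element through letter-indexed data eliminates the cast of arities hidden in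
    [permute]; the operad axioms are then checked letter by letter. *)
Lemma fam_permute m n (f : 'I_n -> 'I_m) (fb : bijective f) (x : X m) i :
  fam (permute fb x) i = fam x (f i).
Proof.
by rewrite fam_sact fam_cast permE /= cast_ord_comp cast_ord_id.
Qed.

End Letters.

Section Invariants.
Variables (C : Type) (inv : forall n, X n -> C).
Hypothesis inv_sact : forall n (x : X n) s, inv (sact x s) = inv x.

Lemma inv_cast m n (e : m = n) (x : X m) : inv (cast_arity e x) = inv x.
Proof. by case: _ / e. Qed.

Lemma inv_permute m n (f : 'I_n -> 'I_m) (fb : bijective f) (x : X m) :
  inv (permute fb x) = inv x.
Proof. by rewrite inv_sact inv_cast. Qed.

End Invariants.
End Families.

(** * Discrete spaces *)

Section Discrete.
Local Open Scope classical_set_scope.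

(** [{classic T}] provides the equality and choice structures underlying a topological space. *)
Definition discrete (T : Type) : topologicalType :=
  discrete_topology {classic T}.

Lemma discrete_nbhs T (x : discrete T) : nbhs x [set x].
Proof. exact: (@discrete_set1 (discrete_topology {classic T}) x). Qed.

Lemma discrete_hausdorff T : hausdorff_space (discrete T).
Proof.
move=> x y /(_ [set x] [set y] (@discrete_nbhs _ x) (@discrete_nbhs _ y)).
by case=> z [/= ->].
Qed.

Lemma discrete_continuous T (V : topologicalType) (f : discrete T -> V) :
  continuous f.
Proof.
move=> x A Ax; have Afx : A (f x) by exact: nbhs_singleton Ax.
have sub : [set x] `<=` [set y | A (f y)] by move=> y ->.
exact: (@filterS _ (nbhs x) (nbhs_filter x) _ _ sub (@discrete_nbhs _ x)).
Qed.

(** Only finitely many factors occur, so points of the product are open. *)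
Lemma discrete_prod_continuous k T (S : 'I_k -> Type) (V : topologicalType)
    (f : discrete T * prod_topology (fun r => discrete (S r)) -> V) :
  continuous f.
Proof.
move=> [x y] A Axy; have Af : A (f (x, y)) by exact: nbhs_singleton Axy.
have near_y : \forall y' \near (y : prod_topology (fun r => discrete (S r))),
    forall r, y' r = y r.
  apply: (@filter_forall _ _
      (fun r (y' : prod_topology (fun r => discrete (S r))) => y' r = y r)
      _ (nbhs_filter y)) => r.
  have H : forall B : set (discrete (S r)), nbhs (y r) B ->
      nbhs (y : prod_topology (fun r => discrete (S r))) [set h | B (h r)].
    exact: (@proj_continuous _ (fun r => discrete (S r)) r y).
  exact: (H _ (@discrete_nbhs _ (y r))).
exists ([set x], [set y' | forall r, y' r = y r]).
  by split=> //; exact: discrete_nbhs.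
case=> x' y' [/= -> yy'].
by have -> : y' = y by exact: functional_extensionality_dep.
Qed.

End Discrete.

(** * The operad of injections *)

Section InjectionOperad.
Variables (gT : finGroupType) (A : Type) (act : gT -> A -> A).
Hypotheses (act1 : forall a, act 1%g a = a)
  (actM : forall g h a, act (g * h)%g a = act g (act h a)).

Lemma act_invK g : cancel (act g) (act g^-1%g).
Proof. by move=> a; rewrite -actM mulVg act1. Qed.

Lemma act_invVK g : cancel (act g^-1%g) (act g).
Proof. by move=> a; rewrite -actM mulgV act1. Qed.

Record injop n := Injop {
  injop_fun :> 'I_n -> A -> A;
  injopP : forall i j a b, injop_fun i a = injop_fun j b -> i = j /\ a = b }.

Lemma injop_eq n (f g : injop n) : (forall i a, f i a = g i a) -> f = g.
Proof.
case: f g => [f fP] [g gP] /= fg.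
have {}fg : f = g by apply: funext => i; apply: funext => a.
by case: _ / fg gP => gP; congr Injop; exact: Prop_irrelevance.
Qed.

Definition injop_gact n (g : gT) (f : injop n) : injop n.
Proof.
exists (fun i a => act g (f i (act g^-1%g a))).
move=> i j a b /(can_inj (act_invK g)) /injopP[-> ab].
by rewrite (can_inj (act_invVK g) ab).
Defined.

Definition injop_sact n (f : injop n) (s : 'S_n) : injop n.
Proof. by exists (fun i => f (s i)) => i j a b /injopP[/perm_inj-> ->]. Defined.

Definition injop_one : injop 1.
Proof. by exists (fun _ a => a) => i j a b ->; rewrite !ord1. Defined.

Definition injop_comp k (n : 'I_k -> nat) (f : injop k)
  (h : forall r, injop (n r)) : injop (\sum_(r < k) n r)%N.
Proof.
exists (fun p a => f (tagnat.sig1 p) (h (tagnat.sig1 p) (tagnat.sig2 p) a)).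
move=> p p' a b /injopP[]; rewrite -[p]tagnat.sigK -[p']tagnat.sigK.
rewrite /tagnat.sig2 /tagnat.sig1 !tagnat.rankK.
case: (tagnat.sig p) (tagnat.sig p') => r q [r' q'] /= rr'.
by case: _ / rr' q' => q' /injopP[-> ->].
Defined.

Definition injop_spaces : symGspaces gT.
Proof.
apply: (@SymGspaces gT (fun n => discrete (injop n))
  (fun n => @discrete_hausdorff _) injop_gact _ _ _ injop_sact).
- by move=> n f; apply: injop_eq => i a /=; rewrite invg1 !act1.
- by move=> n g h f; apply: injop_eq => i a /=; rewrite invMg !actM.
- by move=> n g; exact: discrete_continuous.
- by move=> n f; apply: injop_eq => i a /=; rewrite perm1.
- by move=> n f s t; apply: injop_eq => i a /=; rewrite permM.
- by move=> n s; exact: discrete_continuous.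
- by move=> n g f s; apply: injop_eq.
Defined.

Local Notation I n := (injop_spaces n).
Definition injop_app n (f : I n) : 'I_n -> A -> A := injop_fun f.

Lemma injop_cast m n (e : m = n) (f : I m) i :
  injop_app (cast_arity e f) i = injop_app f (cast_ord (esym e) i).
Proof. exact: (fam_cast injop_app). Qed.

Lemma injop_permute m n (s : 'I_n -> 'I_m) (sb : bijective s) (f : I m) i :
  injop_app (permute sb f) i = injop_app f (s i).
Proof. exact: (fam_permute (fam := injop_app)). Qed.

Lemma injop_appP n (f g : I n) :
  (forall i a, injop_app f i a = injop_app g i a) -> f = g.
Proof. exact: injop_eq. Qed.

Definition injop_goperad : Goperad gT.
Proof.
apply: (@GOperad gT injop_spaces injop_one injop_comp).
- by move=> g; apply: injop_appP => i a /=; rewrite act_invVK.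
- by move=> k n g x y; apply: injop_appP => i a /=; rewrite act_invK.
- by move=> k n; exact: discrete_prod_continuous.
- move=> n x; apply: injop_appP => i a; rewrite injop_cast.
  by rewrite /= -sig2_big_ord1 cast_ord_comp cast_ord_id.
- move=> n x; apply: injop_appP => i a; rewrite injop_cast.
  by rewrite /= -sig1_sum1_ord cast_ord_comp cast_ord_id.
- move=> k j i x y z; apply: injop_appP => p a; rewrite injop_cast.
  exact: (sig_sum_sum_ord
    (fun r q e => x r (y r q (injop_app (z r q) e a)))).
- move=> k n s x y; apply: injop_appP => p a; rewrite injop_permute /=.
  rewrite (sig_Rank (fun r q => x r (injop_app (y (s^-1%g r)) q a))).
  congr (injop_fun x _ _).
  by apply: (sig_cast (fun r q => injop_app (y r) q a)); rewrite ?permK.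
- move=> k n t x y; apply: injop_appP => p a; rewrite injop_permute /=.
  by rewrite (sig_Rank (fun r q => injop_fun x r (injop_app (y r) q a))).
Defined.

End InjectionOperad.

(** * The operad of lenses and its action on injections *)

Section LensOperad.
Variables (gT : finGroupType) (A : Type) (act : gT -> A -> A).
Hypotheses (act1 : forall a, act 1%g a = a)
  (actM : forall g h a, act (g * h)%g a = act g (act h a)).
Variables (L : Type) (lact : gT -> L -> L) (sep : L -> L -> Prop).
Hypotheses (lact1 : forall l, lact 1%g l = l)
  (lactM : forall g h l, lact (g * h)%g l = lact g (lact h l))
  (sep_irr : forall l, ~ sep l l)
  (sep_act : forall g l l', sep l l' -> sep (lact g l) (lact g l')).

Local Notation act_invK := (act_invK act1 actM).
Local Notation act_invVK := (act_invVK act1 actM).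

(** Divergence survives a common prefix and arbitrary suffixes, which is what composition of lenses
    adds to words. *)
Definition diverge (u v : seq L) : Prop :=
  exists w l l' u' v', [/\ u = w ++ l :: u', v = w ++ l' :: v' & sep l l'].

Lemma diverge_catr u v u' v' : diverge u v -> diverge (u ++ u') (v ++ v').
Proof.
case=> w [l [l' [x [y [-> -> ll']]]]]; exists w, l, l', (x ++ u'), (y ++ v').
by rewrite -!catA.
Qed.

Lemma diverge_catl w u v : diverge u v -> diverge (w ++ u) (w ++ v).
Proof.
case=> z [l [l' [x [y [-> -> ll']]]]]; exists (w ++ z), l, l', x, y.
by rewrite -!catA.
Qed.

Lemma diverge_map g u v :
  diverge u v -> diverge (map (lact g) u) (map (lact g) v).
Proof.
case=> z [l [l' [x [y [-> -> ll']]]]].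
exists (map (lact g) z), (lact g l), (lact g l'), (map (lact g) x),
  (map (lact g) y); rewrite !map_cat; split=> //; exact: sep_act.
Qed.

Lemma diverge_irr u : ~ diverge u u.
Proof.
case=> w [l [l' [x [y [-> E]]]]]; suff -> : l = l' by exact: sep_irr.
by elim: w E => [|a w IHw] [].
Qed.

(* Two points related by [lens_rel] differ only in the n components read by the
   maps [(lens_arm i).2]: by [lens_put] and [lens_ext], each class is a copy of
   A^n. The words [(lens_arm i).1] do not act: they only bound the isotropy. *)
Record lensop n := Lensop {
  lens_arm : 'I_n -> seq L * (A -> A);
  lens_rel : A -> A -> Prop;
  lens_diverge : forall i j, i <> j ->
    diverge (lens_arm i).1 (lens_arm j).1;
  lens_refl : forall a, lens_rel a a;
  lens_sym : forall a b, lens_rel a b -> lens_rel b a;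
  lens_trans : forall b a c, lens_rel a b -> lens_rel b c -> lens_rel a c;
  lens_put : forall a (v : 'I_n -> A),
    exists b, lens_rel a b /\ forall i, (lens_arm i).2 b = v i;
  lens_ext : forall a b, lens_rel a b ->
    (forall i, (lens_arm i).2 a = (lens_arm i).2 b) -> a = b }.

Lemma lensop_eq n (x y : lensop n) : lens_arm x =1 lens_arm y ->
  (forall a b, lens_rel x a b <-> lens_rel y a b) -> x = y.
Proof.
case: x y => [f R d r s t p e] [f' R' d' r' s' t' p' e'] /= /funext ff' RR'.
have {}RR' : R = R' by do 2!apply: funext => ?; exact/propext/RR'.
case: _ / ff' in d' p' e' *; case: _ / RR' in r' s' t' p' e' *.
by congr Lensop; exact: Prop_irrelevance.
Qed.

Definition lens_gact n (g : gT) (x : lensop n) : lensop n.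
Proof.
apply: (@Lensop n
  (fun i => (map (lact g) (lens_arm x i).1,
             fun a => act g ((lens_arm x i).2 (act g^-1%g a))))
  (fun a b => lens_rel x (act g^-1%g a) (act g^-1%g b))).
- by move=> i j ij; exact/diverge_map/lens_diverge.
- by move=> a; exact: lens_refl.
- by move=> a b; exact: lens_sym.
- by move=> b a c; exact: lens_trans.
- move=> a v; have [b [ab bv]] := lens_put x (act g^-1%g a) (act g^-1%g \o v).
  exists (act g b); rewrite act_invK; split=> // i.
  by rewrite /= act_invK bv /= act_invVK.
- move=> a b ab E; apply: (can_inj (act_invVK g)); apply: lens_ext ab _ => i.
  exact: (can_inj (act_invK g)) (E i).
Defined.

Definition lens_sact n (x : lensop n) (s : 'S_n) : lensop n.
Proof.
apply: (@Lensop n (fun i => lens_arm x (s i)) (lens_rel x)).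
- by move=> i j ij; apply: lens_diverge => /perm_inj.
- exact: lens_refl.
- exact: lens_sym.
- exact: lens_trans.
- move=> a v; have [b [ab bv]] := lens_put x a (fun i => v (s^-1%g i)).
  by exists b; split=> // i; rewrite bv permK.
- move=> a b ab E; apply: lens_ext ab _ => i.
  by have := E (s^-1%g i); rewrite permKV.
Defined.

Definition lens_one : lensop 1.
Proof.
apply: (@Lensop 1 (fun=> ([::], id)) (fun _ _ => True)) => //.
- by move=> i j; rewrite !ord1.
- move=> a v; exists (v ord0); split=> // i; congr v; apply: val_inj.
  by case: i => [[]].
- by move=> a b _ /(_ ord0).
Defined.

(** A point is read through [x] and then through the [y r]. Its remainder consists of the remainder
    for [x] and, for each r, that of the r-th component for [y r]. *)
Definition lens_comp k (n : 'I_k -> nat) (x : lensop k)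
  (y : forall r, lensop (n r)) : lensop (\sum_(r < k) n r)%N.
Proof.
pose arm r q := ((lens_arm x r).1 ++ (lens_arm (y r) q).1,
                 (lens_arm (y r) q).2 \o (lens_arm x r).2).
apply: (@Lensop _ (fun p => arm (tagnat.sig1 p) (tagnat.sig2 p))
  (fun a b => lens_rel x a b /\ forall r,
     lens_rel (y r) ((lens_arm x r).2 a) ((lens_arm x r).2 b))).
- move=> p p'; rewrite -[p]tagnat.sigK -[p']tagnat.sigK.
  rewrite /tagnat.sig2 /tagnat.sig1 !tagnat.rankK.
  case: (tagnat.sig p) (tagnat.sig p') => r q [r' q'] /= ne.
  (* Within one block the words share the prefix from [x] and diverge in [y r]; across blocks they
     diverge already in [x]. *)
  have [rr'|] := pselect (r = r').
    case: _ / rr' q' ne => q' ne; apply/diverge_catl/lens_diverge => qq'.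
    by apply: ne; rewrite qq'.
  by move/(lens_diverge x)/diverge_catr; exact.
- by move=> a; split=> [|r]; exact: lens_refl.
- by move=> a b [xab yab]; split=> [|r]; apply: lens_sym.
- move=> b a c [xab yab] [xbc ybc]; split=> [|r]; first exact: lens_trans xbc.
  exact: lens_trans (ybc r).
- move=> a v.
  (* Overwrite inside each component read by [x], then write the new components back through [x]. *)
  have put_y r : exists b, lens_rel (y r) ((lens_arm x r).2 a) b /\
      forall q, (lens_arm (y r) q).2 b = v (tagnat.Rank r q).
    exact: lens_put.
  have [w wP] := choice put_y; have [b [xab bw]] := lens_put x a w.
  exists b; split; first by split=> // r; rewrite bw; case: (wP r).
  move=> p; rewrite /= bw; case: (wP (tagnat.sig1 p)) => _ ->.
  by rewrite tagnat.sig2K.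
- move=> a b [xab yab] E; apply: lens_ext xab _ => r.
  apply: lens_ext (yab r) _ => q; have := E (tagnat.Rank r q).
  by rewrite (sig_Rank (fun r q => arm r q)).
Defined.

Definition lens_spaces : symGspaces gT.
Proof.
apply: (@SymGspaces gT (fun n => discrete (lensop n))
  (fun n => @discrete_hausdorff _) lens_gact _ _ _ lens_sact).
- move=> n x; apply: lensop_eq => [i|a b] /=; rewrite invg1 ?act1 //.
  rewrite [RHS]surjective_pairing -[in RHS](map_id (lens_arm x i).1).
  by congr pair; [exact: eq_map|apply: funext => a; rewrite !act1].
- move=> n g h x; apply: lensop_eq => [i|a b] /=; rewrite invMg ?actM //.
  congr pair; last by apply: funext => a; rewrite !actM.
  by rewrite -map_comp; apply: eq_map => l; exact: lactM.
- by move=> n g; exact: discrete_continuous.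
- by move=> n x; apply: lensop_eq => // i /=; rewrite perm1.
- by move=> n x s t; apply: lensop_eq => // i /=; rewrite permM.
- by move=> n s; exact: discrete_continuous.
- by move=> n g x s; apply: lensop_eq.
Defined.

Local Notation P n := (lens_spaces n).
Definition arm_of n (x : P n) : 'I_n -> seq L * (A -> A) := lens_arm x.
Definition rel_of n (x : P n) : A -> A -> Prop := lens_rel x.

Lemma arm_cast m n (e : m = n) (x : P m) i :
  arm_of (cast_arity e x) i = arm_of x (cast_ord (esym e) i).
Proof. exact: (fam_cast arm_of). Qed.

Lemma arm_permute m n (s : 'I_n -> 'I_m) (sb : bijective s) (x : P m) i :
  arm_of (permute sb x) i = arm_of x (s i).
Proof. exact: (fam_permute (fam := arm_of)). Qed.

Lemma rel_cast m n (e : m = n) (x : P m) :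
  rel_of (cast_arity e x) = rel_of x.
Proof. exact: (inv_cast rel_of). Qed.

Lemma rel_permute m n (s : 'I_n -> 'I_m) (sb : bijective s) (x : P m) :
  rel_of (permute sb x) = rel_of x.
Proof. exact: (inv_permute (inv := rel_of)). Qed.

Lemma lens_spaces_eq n (x y : P n) : arm_of x =1 arm_of y ->
  (forall a b, rel_of x a b <-> rel_of y a b) -> x = y.
Proof. exact: lensop_eq. Qed.

Definition lens_goperad : Goperad gT.
Proof.
apply: (@GOperad gT lens_spaces lens_one lens_comp).
- move=> g; apply: lens_spaces_eq => // i /=; rewrite /arm_of /=; congr pair.
  by apply: funext => a; rewrite act_invVK.
- move=> k n g x y; apply: lens_spaces_eq => [i|a b];
    rewrite /arm_of /rel_of /=.
    by congr pair; [rewrite map_cat|apply: funext => a /=; rewrite act_invK].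
  by split=> -[? yab]; split=> // r; move: (yab r); rewrite !act_invK.
- by move=> k n; exact: discrete_prod_continuous.
- move=> n x; apply: lens_spaces_eq => [i|a b]; rewrite ?arm_cast ?rel_cast.
    rewrite /arm_of /= -sig2_big_ord1 cast_ord_comp cast_ord_id.
    by rewrite [RHS]surjective_pairing.
  by split=> [[_ /(_ ord0)]|].
- move=> n x; apply: lens_spaces_eq => [i|a b]; rewrite ?arm_cast ?rel_cast.
    rewrite /arm_of /= -sig1_sum1_ord cast_ord_comp cast_ord_id cats0.
    by rewrite [RHS]surjective_pairing.
  by split=> [[]|].
- move=> k j i x y z; apply: lens_spaces_eq => [p|a b].
    rewrite arm_cast /arm_of /= -catA.
    exact: (sig_sum_sum_ord (fun r q e =>
      ((lens_arm x r).1 ++ (lens_arm (y r) q).1 ++ (lens_arm (z r q) e).1,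
       (lens_arm (z r q) e).2 \o (lens_arm (y r) q).2 \o (lens_arm x r).2))).
  rewrite rel_cast /rel_of /=; split=> [[[xab yab] zab]|[xab yzab]]; split=> //.
  - move=> r; split=> // q; have := zab (tagnat.Rank r q).
    by rewrite (sig_Rank (fun r q => lens_rel (z r q)
      ((lens_arm (y r) q).2 ((lens_arm x r).2 a))
      ((lens_arm (y r) q).2 ((lens_arm x r).2 b)))).
  - by split=> // r; case: (yzab r).
  - by move=> p; case: (yzab (tagnat.sig1 p)) => _; exact.
- move=> k n s x y; apply: lens_spaces_eq => [p|a b].
    rewrite arm_permute /arm_of /=.
    rewrite (sig_Rank (fun r q =>
      ((lens_arm x r).1 ++ (lens_arm (y (s^-1%g r)) q).1,
       (lens_arm (y (s^-1%g r)) q).2 \o (lens_arm x r).2))).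
    set u := lens_arm (y _) _; set v := lens_arm (y _) _.
    suff -> : u = v by [].
    by apply: (sig_cast (fun r q => lens_arm (y r) q)); rewrite ?permK.
  rewrite rel_permute /rel_of /=; split=> -[xab yab]; split=> // r.
    by have := yab (s^-1%g r); rewrite permKV.
  by have := yab (s r); rewrite permK.
- move=> k n t x y; apply: lens_spaces_eq => [p|a b].
    rewrite arm_permute /arm_of /=.
    by rewrite (sig_Rank (fun r q =>
      ((lens_arm x r).1 ++ (lens_arm (y r) q).1,
       (lens_arm (y r) q).2 \o (lens_arm x r).2))).
  by rewrite rel_permute.
Defined.


Definition lens_update k (n : 'I_k -> nat) (g : lensop k)
    (c : forall r, injop A (n r)) (Q : 'I_(\prod_(r < k) n r)%N) (a : A) : A :=
  projT1 (cid (lens_put g a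
    (fun r => c r (prodnat.digits Q r) ((lens_arm g r).2 a)))).

Section Update.
Variables (k : nat) (n : 'I_k -> nat) (g : lensop k).
Variable c : forall r, injop A (n r).

Lemma lens_updateP Q a : lens_rel g a (lens_update g c Q a) /\
  forall r, (lens_arm g r).2 (lens_update g c Q a) =
    c r (prodnat.digits Q r) ((lens_arm g r).2 a).
Proof. by rewrite /lens_update; case: cid. Qed.

(** [lens_ext] makes the point picked by [cid] unique. Axioms of the operad pair thus reduce to
    checking the class and the components of a candidate. *)
Lemma lens_update_eq Q a b : lens_rel g a b ->
  (forall r, (lens_arm g r).2 b =
    c r (prodnat.digits Q r) ((lens_arm g r).2 a)) ->
  lens_update g c Q a = b.
Proof.
move=> ab bE; have [ab' b'E] := lens_updateP Q a.
apply: lens_ext (lens_trans (lens_sym ab') ab) _ => r.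
by rewrite b'E bE.
Qed.

Definition lens_lam : injop A (\prod_(r < k) n r)%N.
Proof.
exists (lens_update g c) => Q Q' a a' E.
have [ab bE] := lens_updateP Q a; have [ab' bE'] := lens_updateP Q' a'.
(* The r-th component of the common value lies in the image of [c r], whose injectivity recovers
   both the digit and the old component. *)
have digitE r : prodnat.digits Q r = prodnat.digits Q' r /\
    (lens_arm g r).2 a = (lens_arm g r).2 a'.
  by apply: (@injopP _ _ (c r)); rewrite -bE E bE'.
split.
  rewrite -[Q]prodnat.digitsK -[Q']prodnat.digitsK; congr prodnat.rank.
  by apply: functional_extensionality_dep => r; case: (digitE r).
apply: (@lens_ext _ g) => [|r]; last by case: (digitE r).
apply: lens_trans ab _; rewrite E; exact: lens_sym.
Defined.

End Update.

Local Notation injop_goperad := (injop_goperad act1 actM).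

Lemma digits_big_ord1 n (Q : 'I_(\prod_(r < 1) n)%N) r :
  prodnat.digits Q r = cast_ord (big_ord1 _ (fun=> n)) Q.
Proof.
apply: val_inj; rewrite /= /prodnat.weight.
rewrite [X in (_ %/ X)%N]big_pred0; last first.
  by move=> s; rewrite !ord1.
rewrite divn1 modn_small //; apply: leq_trans (ltn_ord Q) _.
by rewrite big_ord1.
Qed.

Definition lens_pair : operad_pair lens_goperad injop_goperad.
Proof.
apply: (@OperadPair gT lens_goperad injop_goperad lens_lam).
- move=> k n h g c; apply: injop_appP => Q a; rewrite /injop_app /=.
  have [ab bE] := lens_updateP g c Q (act h^-1%g a); apply/esym.
  apply: lens_update_eq => [|r] /=; first by rewrite act_invK.
  by rewrite !act_invK bE.
- by move=> k n; exact: discrete_prod_continuous.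
- move=> k j n g g' c; apply: injop_appP => Q a.
  rewrite injop_cast /injop_app /=.
  have [ab bE] := lens_updateP g (fun r => lens_lam (g' r) (c r)) Q a.
  apply: lens_update_eq => [|p] /=.
    by split=> // r; rewrite bE; case: (lens_updateP (g' r) (c r)
      (prodnat.digits Q r) ((lens_arm g r).2 a)).
  set r := tagnat.sig1 p; rewrite bE.
  have [_ ->] := lens_updateP (g' r) (c r) (prodnat.digits Q r)
    ((lens_arm g r).2 a).
  by rewrite digits_prod_prod_ord.
(* Updating by the inner injections [d] and then by the outer ones [c] stays in one class and
   composes them on each component. *)
- move=> k j i g c d; apply: injop_appP => Q a.
  rewrite injop_permute /injop_app /=.
  set R := prodnat.rank (fun r => tagnat.sig1 (prodnat.digits Q r)).
  rewrite (sig_Rank (fun R E => lens_update g c R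
    (lens_update g (fun r => d r (prodnat.digits R r)) E a))).
  set E := prodnat.rank (fun r => cast_ord _ _).
  have [ab bE] := lens_updateP g (fun r => d r (prodnat.digits R r)) E a.
  have [bc cE] := lens_updateP g c R
    (lens_update g (fun r => d r (prodnat.digits R r)) E a).
  apply/esym/lens_update_eq => [|r]; first exact: lens_trans bc.
  rewrite cE bE /=; congr (injop_fun (c r) _ _); first exact: prodnat.rankK.
  apply: (sig_cast (fun q e => injop_fun (d r q) e ((lens_arm g r).2 a))).
    exact: prodnat.rankK.
  by rewrite [prodnat.digits E r](prodnat.rankK _ r).
- move=> n c; apply: injop_appP => Q a; rewrite injop_cast /injop_app /=.
  apply: lens_update_eq => // r; rewrite /= digits_big_ord1.
  by rewrite cast_ord_comp cast_ord_id.
- move=> k g; apply: injop_appP => Q a; rewrite injop_cast /injop_app /=.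
  by apply: lens_update_eq => //; exact: lens_refl.
- move=> k n s g c; apply: injop_appP => Q a.
  rewrite injop_permute /injop_app /=.
  have [ab bE] := lens_updateP g (fun r => c (s^-1%g r)) (factor_perm s Q) a.
  apply: lens_update_eq => // r; rewrite /= bE /factor_perm prodnat.rankK.
  by rewrite permK.
- move=> k n t g c; apply: injop_appP => Q a.
  rewrite injop_permute /injop_app /=.
  have [ab bE] := lens_updateP g c (prod_perm t Q) a.
  by apply: lens_update_eq => // r; rewrite bE /prod_perm prodnat.rankK.
Defined.

End LensOperad.

(** * Isotropy and transfers *)

Section Isotropy.
Local Open Scope ring_scope.
Variables (R : realType) (gT : finGroupType) (U : orthRep R gT).
Hypothesis U_universe : universe U.

Definition isotropy (M : {group gT}) : Prop :=
  exists u : U, forall g, g \in M <-> rep_act U g u = u.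

Lemma isotropyT : isotropy [set: gT]%G.
Proof. by exists 0 => g; rewrite finset.in_setT linear0. Qed.

(** The orbits of u and v span a finite-dimensional subrepresentation V, so V^2 embeds in [U]; the
    image of (u, v) has the intersection as stabilizer. *)
Lemma isotropyI M N : isotropy M -> isotropy N -> isotropy (M :&: N)%G.
Proof.
case=> u uP [v vP]; pose J : finType := (gT * bool)%type.
pose b (i : 'I_#|J|) := let: (g, e) := enum_val i in
  rep_act U g (if e then u else v).
pose V : set U := (fun w => exists c : 'I_#|J| -> R, w = \sum_i c i *: b i).
have V_b i : V (b i).
  exists (fun j => (j == i)%:R); rewrite (bigD1 i) //= eqxx scale1r.
  by rewrite big1 ?addr0 // => j /negbTE->; rewrite scale0r.
have V0 : V 0 by exists (fun=> 0); rewrite big1 // => i _; rewrite scale0r.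
have VD (a : R) w w' : V w -> V w' -> V (a *: w + w').
  move=> [c ->] [d ->]; exists (fun i => a * c i + d i).
  rewrite scaler_sumr -big_split; apply: eq_bigr => i _.
  by rewrite scalerDl scalerA.
have b_act g i : V (rep_act U g (b i)).
  suff -> : rep_act U g (b i) =
    b (enum_rank ((g * (enum_val i).1)%g, (enum_val i).2)) by [].
  by rewrite /b enum_rankK; case: (enum_val i) => h e; rewrite rep_actM.
have V_subrep : subrep V.
  split=> // g _ [c ->]; rewrite linear_sum.
  elim/big_ind: _ => // [x y Vx Vy|i _].
    by rewrite -[x]scale1r; exact: VD.
  by rewrite linearZ -[X in V X]addr0; exact: VD (b_act g i) V0.
have V_fin : finite_dim V by exists #|J|, b; split=> // w [c ->]; exists c.
have [_ _ /(_ V V_subrep V_fin 2)] := U_universe.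
case=> f [_ f_act f_inj].
pose w := [ffun i : 'I_2 => if i == ord0 then u else v].
have V_uv e : V (if e then u else v).
  suff -> : (if e then u else v) = b (enum_rank (1%g, e)) by [].
  by rewrite /b enum_rankK rep_act1.
have Vw i : V (w i) by rewrite ffunE; exact: V_uv.
exists (f w) => g; rewrite finset.inE; split.
  move=> /andP[/uP gu /vP gv]; rewrite -f_act //; congr f; apply/ffunP => i.
  by rewrite !ffunE; case: eqP.
rewrite -f_act // => /f_inj E; have {}E : [ffun i => rep_act U g (w i)] = w.
  apply: E => // i; rewrite ffunE; case: V_subrep => _ _; exact.
apply/andP; split; [apply/uP; have /ffunP/(_ ord0) := E|
  apply/vP; have /ffunP/(_ (lift ord0 ord0)) := E]; by rewrite !ffunE.
Qed.

(** An equivariant embedding sends the coset [K] to a vector whose stabilizer meets [H] in [K].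
    Conversely, acting on a vector u with stabilizer M identifies the cosets of [H :&: M] in [H]
    with the orbit of u under [H]. *)
Lemma discs_transferP (K H : {group gT}) :
  discs_transfer U K H <->
  exists2 M, isotropy M & K = (H :&: M)%G.
Proof.
split=> [[sKH [f [f_inj f_act]]]|[M [u uP] ->]].
  have lK h : h \in H -> (h *: K)%g \in lcosets K H.
    by move=> hH; apply/lcosetsP; exists h.
  have K1 : (K : {set gT}) \in lcosets K H.
    by rewrite -[X in X \in _]lcoset1 lK.
  pose S := [set g | rep_act U g (f K) == f K]%SET.
  have gS : group_set S.
    apply/group_setP; split=> [|g h]; first by rewrite finset.inE rep_act1.
    by rewrite !finset.inE rep_actM => /eqP gf /eqP->; rewrite gf.
  exists (Group gS).
    by exists (f K) => g; rewrite finset.inE; split=> /eqP.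
  apply/group_inj/setP => h; rewrite !finset.inE; apply/idP/andP.
    move=> hK; have hH : h \in H by exact: (fintype.subsetP sKH).
    by split=> //; apply/eqP; rewrite -f_act // lcoset_id.
  case=> hH /eqP; rewrite -f_act // => /f_inj E.
  by rewrite -[K : {set gT}]E ?lK // lcoset_refl.
split; first exact: subsetIl.
exists (fun X => rep_act U (repr X) u).
have fE x : rep_act U (repr (x *: (H :&: M)%G))%g u = rep_act U x u.
  have /lcosetP[m] := mem_repr _ (lcoset_refl (H :&: M)%G x).
  by rewrite inE => /andP[_ /uP mu] ->; rewrite rep_actM mu.
split=> [X Y /lcosetsP[x xH ->] /lcosetsP[y yH ->]|h X hH /lcosetsP[x xH ->]].
  rewrite !fE => E; apply/lcoset_eqP; rewrite mem_lcoset inE groupM ?groupV //=.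
  by apply/uP; rewrite rep_actM E -rep_actM mulVg rep_act1.
by rewrite -lcosetM !fE rep_actM.
Qed.

End Isotropy.

(** * The equivariant Cantor-Bernstein theorem *)

Section CantorBernstein.
Variables (gT : finGroupType) (H : {group gT}) (A C : Type).
Variables (toA : gT -> A -> A) (toC : gT -> C -> C).
Hypothesis toAK : forall h, h \in H -> cancel (toA h) (toA h^-1%g).
Variables (f : A -> C) (g : C -> A).
Hypotheses (f_inj : injective f) (g_inj : injective g).
Hypotheses (fH : forall h a, h \in H -> f (toA h a) = toC h (f a))
  (gH : forall h c, h \in H -> g (toC h c) = toA h (g c)).

(** The points whose chain of preimages begins outside the image of [g]: there the bijection is [f],
    elsewhere it inverts [g]. *)
Definition cb_chain (a : A) : Prop :=
  exists m a0, (forall c, a0 <> g c) /\ a = iter m (g \o f) a0.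

Lemma cb_chainH h a : h \in H -> cb_chain a -> cb_chain (toA h a).
Proof.
move=> hH [m [a0 [a0g ->]]]; exists m, (toA h a0); split.
  move=> c /(congr1 (toA h^-1%g)); rewrite toAK // -gH ?groupV //; exact: a0g.
by elim: m => //= m <-; rewrite fH // gH.
Qed.

(** [cb_chain] is stable under [H], so the two halves of the classical bijection glue
    equivariantly. *)
Lemma equivariant_cantor_bernstein : exists phi : A -> C,
  [/\ injective phi, forall c, exists a, phi a = c
    & forall h a, h \in H -> phi (toA h a) = toC h (phi a)].
Proof.
have back a : exists c, ~ cb_chain a -> a = g c.
  have [[c ->]|nog] := pselect (exists c, a = g c); first by exists c.
  (* Outside the image of [g] a point starts its own chain, so the requirement on the default [f a]
     is vacuous. *)
  exists (f a) => -[]; exists 0%N, a; split=> // c ac; apply: nog; by exists c.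
have [b bP] := choice back.
pose phi a := if pselect (cb_chain a) then f a else b a.
have chainS a : cb_chain a -> cb_chain (g (f a)).
  by case=> m [a0 [a0g ->]]; exists m.+1, a0.
have chainH h a : h \in H -> cb_chain (toA h a) -> cb_chain a.
  move=> hH /(cb_chainH (groupVr hH)); by rewrite toAK.
have phiS a : cb_chain a -> phi a = f a by rewrite /phi; case: pselect.
have phiN a : ~ cb_chain a -> g (phi a) = a.
  by rewrite /phi; case: pselect => // nSa _; rewrite -bP.
exists phi; split=> [a a'|c|h a hH].
- have [Sa|nSa] := pselect (cb_chain a);
    have [Sa'|nSa'] := pselect (cb_chain a').
  + by rewrite !phiS //; exact: f_inj.
  + rewrite phiS // => E; have := phiN a' nSa'; rewrite -E => ga.
    by case: nSa'; rewrite -ga; exact: chainS.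
  + rewrite [phi a']phiS // => E; have := phiN a nSa; rewrite E => ga.
    by case: nSa; rewrite -ga; exact: chainS.
  + by move/(congr1 g); rewrite !phiN.
- have [[[|m] [a0 [a0g /=]]]|nS] := pselect (cb_chain (g c)).
  + by move=> /esym/a0g.
  + move=> /g_inj ->; exists (iter m (g \o f) a0); apply: phiS.
    by exists m, a0.
  + by exists (g c); apply: g_inj; exact: phiN.
- have [Sa|nSa] := pselect (cb_chain a).
    by rewrite !phiS ?fH //; exact: cb_chainH.
  have nSha : ~ cb_chain (toA h a) by move/(chainH _ _ hH).
  by apply: g_inj; rewrite gH // !phiN.
Qed.

End CantorBernstein.

(** * The G-set A and equivariant maps to and from it *)

Section CosetSets.
Local Open Scope group_scope.
Variables (gT : finGroupType) (gT_abelian : abelian [set: gT]).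
Variable I : {group gT} -> Prop.
Hypotheses (IT : I [set: gT]%G)
  (II : forall M N, I M -> I N -> I (M :&: N)%G).
Implicit Types H K L M N : {group gT}.

Lemma abelian_mulC (x y : gT) : x * y = y * x.
Proof. by apply: (centsP gT_abelian); rewrite finset.in_setT. Qed.

Lemma lcoset_fixed (h x : gT) M : (h *: (x *: M) == x *: M) = (h \in M).
Proof.
rewrite -lcosetM; apply/eqP/idP => [E|hM].
  have := lcoset_refl M (h * x); rewrite E mem_lcoset.
  by rewrite (abelian_mulC h) mulKg.
by rewrite (abelian_mulC h) lcosetM lcoset_id.
Qed.

Lemma bigcap_isotropy (J : finType) (M : J -> {group gT}) :
  (forall j, I (M j)) ->
  exists2 N, I N & forall h, h \in N <-> forall j, h \in M j.
Proof.
move=> IM; suff [N IN NP] : exists2 N, I N &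
    forall h, h \in N <-> forall j, j \in enum J -> h \in M j.
  by exists N => // h; split=> [/NP hM j|hM]; [apply/hM/mem_enum|apply/NP].
elim: (enum J) => [|j r [N IN NP]].
  by exists [set: gT]%G => // h; split=> // _; rewrite finset.in_setT.
exists (M j :&: N)%G => [|h]; first exact: II.
rewrite finset.in_setI; split=> [/andP[hj /NP hr] l|hr].
  by rewrite inE => /orP[/eqP->|/hr].
apply/andP; split; first by apply: hr; rewrite mem_head.
by apply/NP => l lr; apply: hr; rewrite inE lr orbT.
Qed.

(* A countable G-set in which every member of I, and no other subgroup, is the
   stabilizer of infinitely many orbits. *)
Definition coset_type :=
  {X : {set gT} | `[< exists2 M, I M & exists x, X = x *: M >]}.
Definition coset_set := (coset_type * nat)%type.

Lemma coset_act_subproof g (X : coset_type) :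
  `[< exists2 M, I M & exists x, g *: val X = x *: M >].
Proof.
case: X => X /= /asboolP[M IM [x ->]]; apply/asboolP; exists M => //.
by exists (g * x); rewrite lcosetM.
Qed.

Definition coset_act g (a : coset_set) : coset_set :=
  (exist _ (g *: val a.1) (coset_act_subproof g a.1), a.2).

Lemma coset_act1 a : coset_act 1 a = a.
Proof. by case: a => X m; congr pair; apply: val_inj; exact: lcoset1. Qed.

Lemma coset_actM g h a : coset_act (g * h) a = coset_act g (coset_act h a).
Proof. by case: a => X m; congr pair; apply: val_inj; exact: lcosetM. Qed.

Lemma coset_stab a :
  exists2 M, I M & forall h, coset_act h a = a <-> h \in M.
Proof.
case: a => -[X XP] m; have /asboolP[M IM [x Xx]] := XP.
exists M => // h; rewrite -(lcoset_fixed h x) -Xx; split=> [[->] //|/eqP hX].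
by congr pair; exact: val_inj.
Qed.

Definition mk_coset M (IM : I M) (x : gT) (m : nat) : coset_set :=
  (exist (fun X : {set gT} => `[< exists2 M, I M & exists x, X = x *: M >])
     (x *: M) (asboolT (ex_intro2 _ _ M IM (ex_intro _ x erefl))), m).

Lemma coset_act_mk M (IM : I M) g x m :
  coset_act g (mk_coset IM x m) = mk_coset IM (g * x) m.
Proof. by congr pair; apply: val_inj; rewrite /= lcosetM. Qed.

Lemma mk_coset_eq M (IM : I M) x m M' (IM' : I M') x' m' :
  m = m' -> x *: M = x' *: M' -> mk_coset IM x m = mk_coset IM' x' m'.
Proof. by move=> -> E; congr pair; exact: val_inj. Qed.

Section Embedding.
Variables (H : {group gT}) (C : countType) (to : gT -> C -> C).
Hypotheses (to1 : forall c, to 1 c = c)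
  (toM : {in H &, forall g h c, to (g * h) c = to g (to h c)}).
Hypothesis to_stab : forall c,
  exists2 M, I M & forall h, h \in H -> (to h c = c <-> h \in M).

(** An [H]-orbit with stabilizer [H :&: M] embeds in G / M. The code of its representative selects
    the copy of G / M, so distinct orbits land in distinct copies. *)
Lemma coset_set_embedding :
  exists2 beta : C -> coset_set, injective beta &
    forall h c, h \in H -> beta (to h c) = coset_act h (beta c).
Proof.
pose orb c : pred C := fun d => [exists h in H, d == to h c].
have orbP c d : reflect (exists2 h, h \in H & d = to h c) (orb c d).
  by apply: (iffP exists_inP) => -[h hH /eqP ?]; exists h => //; apply/eqP.
have orb_refl c : orb c c by apply/orbP; exists 1; rewrite ?group1 ?to1.
have orbH h c : h \in H -> orb (to h c) =1 orb c.
  move=> hH d; apply/orbP/orbP => -[g gH ->].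
    by exists (g * h); rewrite ?groupM // toM.
  by exists (g * h^-1); rewrite -?toM ?mulgKV ?groupM ?groupV.
(* [choose] gives the same result from every starting point of the orbit. *)
pose rep c := choose (orb c) c.
have repH h c : h \in H -> rep (to h c) = rep c.
  move=> hH; rewrite /rep (eq_choose (orbH h c hH)).
  by apply: choose_id => //; apply/orbP; exists h.
have repP c : exists h, h \in H /\ c = to h (rep c).
  have /orbP[h hH E] : orb c (rep c) by exact: chooseP.
  by exists h^-1; rewrite ?groupV // E -toM ?groupV // mulVg to1.
have [tr trP] := choice repP.
have stabP c : exists M, I M /\ forall h, h \in H -> (to h c = c <-> h \in M).
  by have [N] := to_stab c; exists N.
have [M MP] := choice stabP.
have IM c : I (M c) by case: (MP c).
have cosetE c g h : g \in H -> h \in H ->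
    to g c = to h c <-> g *: M c = h *: M c.
  move=> gH hH; have hgH : h^-1 * g \in H by rewrite groupM ?groupV.
  have [_ /(_ _ hgH) hgP] := MP c; split=> [E|/lcoset_eqP].
    apply/lcoset_eqP; rewrite mem_lcoset; apply/hgP.
    by rewrite toM ?groupV // E -toM ?groupV // mulVg to1.
  by rewrite mem_lcoset => /hgP {2}<-; rewrite -toM // mulKVg.
exists (fun c => mk_coset (IM (rep c)) (tr c) (pickle (rep c))).
  move=> c d [E /(pcan_inj pickleK) Ecd].
  have [trc Ec] := trP c; have [trd Ed] := trP d; rewrite Ec Ed Ecd.
  by apply/cosetE => //; rewrite -[in LHS]Ecd.
move=> h c hH; rewrite coset_act_mk; apply: mk_coset_eq; rewrite repH //.
have [trc Ec] := trP c; have [trh Eh] := trP (to h c).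
apply/cosetE; rewrite ?groupM //; rewrite toM // -Ec.
by rewrite [RHS]Eh repH.
Qed.

End Embedding.

Section PermutationActions.
Variables (H : {group gT}) (n : nat) (s : gT -> 'S_n).
Hypothesis sM : {in H &, {morph s : g h / g * h}}.

Lemma perm_act1 : s 1 = 1.
Proof. by apply: (mulgI (s 1)); rewrite -sM ?group1 // !mulg1. Qed.

Lemma perm_actM g h i : g \in H -> h \in H -> s (g * h) i = s h (s g i).
Proof. by move=> gH hH; rewrite sM // permM. Qed.

Lemma perm_actK h : h \in H -> cancel (s h) (s h^-1).
Proof. by move=> hH i; rewrite -perm_actM ?groupV // mulgV perm_act1 perm1. Qed.

Lemma perm_actVK h : h \in H -> cancel (s h^-1) (s h).
Proof. by move=> hH i; rewrite -perm_actM ?groupV // mulVg perm_act1 perm1. Qed.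

(** The [H]-set of letters is a disjoint union of orbits H / K with [T K H]. *)
Definition admissible (T : {group gT} -> {group gT} -> Prop) : Prop :=
  forall i, exists2 K, T K H & forall h, h \in K <-> h \in H /\ s h i = i.

Definition isotropy_transfer (K L : {group gT}) : Prop :=
  exists2 M, I M & K = (L :&: M)%G.

Section Injections.
Hypothesis s_adm : admissible isotropy_transfer.

(** A fixed point is an [H]-equivariant embedding of n * A into A; it exists because the stabilizer
    of (i, a) is the intersection of [H] with two members of [I]. *)
Lemma injop_fixed_exists : exists x : injop coset_set n,
  forall h, h \in H ->
    injop_gact coset_act1 coset_actM h (injop_sact x (s h)) = x.
Proof.
(* [s] is a right action on letters, whence the inverse. *)
pose to h (c : 'I_n * coset_set) := (s h^-1 c.1, coset_act h c.2).
have [||c|beta beta_inj betaH] := @coset_set_embedding H _ to.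
- by case=> i a; rewrite /to /= invg1 perm_act1 perm1 coset_act1.
- move=> g h gH hH [i a]; rewrite /to /= invMg perm_actM ?groupV //.
  by rewrite coset_actM.
- case: c => i a; have [K [M IM ->] KP] := s_adm i.
  have [N IN NP] := coset_stab a; exists (M :&: N)%G; first exact: II.
  move=> h hH; rewrite finset.in_setI; have [KP1 KP2] := KP h.
  rewrite /to; split=> [[si ai]|/andP[hM /NP ai]].
    apply/andP; split; last exact/NP.
    have : h \in (H :&: M)%G.
      by apply: KP2; split=> //; rewrite -[in LHS]si perm_actVK.
    by rewrite finset.in_setI => /andP[].
  congr pair => //=; have [|_ si] := KP1; first by rewrite finset.in_setI hH.
  by rewrite -[in LHS]si perm_actK.
have xP i j a b : beta (i, a) = beta (j, b) -> i = j /\ a = b.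
  by move=> /beta_inj[-> ->].
exists (Injop (injop_fun := fun i a => beta (i, a)) xP) => h hH.
apply: injop_eq => i a /=; rewrite -betaH // /to /= perm_actK //.
by rewrite -coset_actM mulgV coset_act1.
Qed.

End Injections.

Section Lenses.
Variable T : {group gT} -> {group gT} -> Prop.
Hypothesis T_compat : forall H K L, K \subset H -> L \subset H -> T K H ->
  isotropy_transfer (K :&: L)%G K -> isotropy_transfer L H.
Hypothesis s_adm : admissible T.

(** The product A^n * B to be identified with A, for B = A. *)
Definition arrays := ({ffun 'I_n -> coset_set} * coset_set)%type.

Definition array_act h (c : arrays) : arrays :=
  ([ffun i => coset_act h (c.1 (s h i))], coset_act h c.2).

Lemma array_act1 c : array_act 1 c = c.
Proof.
case: c => f a; rewrite /array_act coset_act1; congr pair.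
by apply/ffunP => i; rewrite ffunE perm_act1 perm1 coset_act1.
Qed.

Lemma array_actM :
  {in H &, forall g h c, array_act (g * h) c = array_act g (array_act h c)}.
Proof.
move=> g h gH hH [f a]; rewrite /array_act coset_actM; congr pair.
by apply/ffunP => i; rewrite !ffunE perm_actM // coset_actM.
Qed.

(* Restricted to the stabilizer K of i, the stabilizer Q of the values of f on
   the H-orbit of i is the intersection of the stabilizers of these values, as
   H is abelian; compatibility of K -> H then gives Q. *)
Lemma orbit_isotropy (f : {ffun 'I_n -> coset_set}) i :
  exists2 M, I M & forall h, h \in H -> h \in M <->
    forall g, g \in H -> coset_act h (f (s h (s g i))) = f (s g i).
Proof.
have [K TKH KP] := s_adm i.
have sKH : K \subset H by apply/fintype.subsetP => h /KP[].
pose Q := [set h in H | [forall g in H,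
  coset_act h (f (s h (s g i))) == f (s g i)]]%SET.
have QP h : reflect (h \in H /\ forall g, g \in H ->
    coset_act h (f (s h (s g i))) = f (s g i)) (h \in Q).
  rewrite finset.inE; apply: (iffP andP) => -[hH fP]; split=> //.
    by move=> g gH; apply/eqP; move/forall_inP: fP; exact.
  by apply/forall_inP => g gH; apply/eqP; exact: fP.
have gQ : group_set Q.
  apply/group_setP; split.
    apply/QP; rewrite group1; split=> // g gH.
    by rewrite perm_act1 perm1 coset_act1.
  move=> h h' /QP[hH hf] /QP[h'H h'f]; apply/QP; split=> [|g gH].
    exact: groupM.
  rewrite perm_actM // coset_actM -[s h (s g i)]perm_actM //.
  by rewrite h'f ?groupM // perm_actM // hf.
have stabP j : exists M, I M /\ forall h, coset_act h (f j) = f j <-> h \in M.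
  by have [M] := coset_stab (f j); exists M.
have [M MP] := choice stabP.
pose Mg (g : gT) := M (s g i).
have [|N IN NP] := @bigcap_isotropy {g | g \in H} (fun g => Mg (val g)).
  by move=> g; case: (MP (s (val g) i)).
have fixK h g : h \in K -> g \in H -> s h (s g i) = s g i.
  move=> /KP[hH hi] gH.
  by rewrite -perm_actM // abelian_mulC perm_actM // hi.
have KQ : isotropy_transfer (K :&: Group gQ)%G K.
  exists N => //; apply/group_inj/setP => h; rewrite !finset.in_setI.
  apply: andb_id2l => hK; apply/idP/idP => [/QP[hH hf]|/NP hN].
    apply/NP => -[g gH]; rewrite /Mg /=.
    by case: (MP (s g i)) => _ <-; rewrite -[in LHS](fixK h g hK gH) hf.
  apply/QP; split=> [|g gH]; first exact: (fintype.subsetP sKH).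
  rewrite fixK //; case: (MP (s g i)) => _ ->.
  exact: (hN (exist _ g gH)).
have sQH : Group gQ \subset H by apply/fintype.subsetP => h /QP[].
have [M' IM' /(congr1 val) /= QE] := T_compat sKH sQH TKH KQ.
exists M' => // h hH.
have <- : (h \in Q) = (h \in M') by rewrite QE finset.in_setI hH.
by split=> [/QP[]|hf]; last apply/QP.
Qed.

Lemma array_stab c : exists2 M, I M &
  forall h, h \in H -> (array_act h c = c <-> h \in M).
Proof.
case: c => f a; have orb i : exists M, I M /\ forall h, h \in H -> h \in M <->
    forall g, g \in H -> coset_act h (f (s h (s g i))) = f (s g i).
  by have [M] := orbit_isotropy f i; exists M.
have [M MP] := choice orb; have [N IN NP] := coset_stab a.
have [|N' IN' N'P] := @bigcap_isotropy 'I_n M; first by move=> i; case: (MP i).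
exists (N' :&: N)%G => [|h hH]; first exact: II.
rewrite finset.in_setI; split=> [[hf ha]|/andP[/N'P hN' /NP ha]].
  apply/andP; split; last exact/NP.
  apply/N'P => i; case: (MP i) => _ -> // g gH.
  by rewrite -[in RHS]hf ffunE.
rewrite /array_act ha; congr pair; apply/ffunP => i; rewrite ffunE.
have := hN' i; case: (MP i) => _ -> // /(_ 1 (group1 _)).
by rewrite perm_act1 perm1.
Qed.

(** Arrays embed in A by [array_stab]; A embeds in arrays as the last component, next to a constant
    family at the G-fixed point [a0]. *)
Lemma array_bijection : exists phi : coset_set -> arrays,
  [/\ injective phi, forall c, exists a, phi a = c
    & forall h a, h \in H -> phi (coset_act h a) = array_act h (phi a)].
Proof.
have [beta beta_inj betaH] :=
  coset_set_embedding array_act1 array_actM array_stab.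
pose a0 := mk_coset IT 1 0.
have a0_fixed h : coset_act h a0 = a0.
  rewrite coset_act_mk; apply: mk_coset_eq => //.
  by rewrite mulg1 lcoset1 lcoset_id ?finset.in_setT.
pose f (a : coset_set) : arrays := ([ffun=> a0], a).
apply: (@equivariant_cantor_bernstein gT H _ _ coset_act array_act _ f beta)
  => //.
- by move=> h hH a; rewrite -coset_actM mulVg coset_act1.
- by move=> a b [].
- by move=> h a hH; congr pair; apply/ffunP => i; rewrite !ffunE a0_fixed.
Qed.

Section Words.
Variables (L : Type) (lact : gT -> L -> L) (sep : L -> L -> Prop).
Hypothesis sep_act : forall g l l', sep l l' -> sep (lact g l) (lact g l').
Variable w : 'I_n -> seq L.
Hypotheses (w_div : forall i j, i <> j -> diverge sep (w i) (w j))
  (wH : forall h i, h \in H -> map (lact h) (w (s h i)) = w i).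

(** The bijection [phi] is the lens: its surjectivity gives [put], its injectivity [ext], and its
    equivariance invariance under [H]. *)
Lemma lensop_fixed_exists : exists x : lensop coset_set sep n,
  forall h, h \in H ->
    lens_gact coset_act1 coset_actM sep_act h (lens_sact x (s h)) = x.
Proof.
have [phi [phi_inj phi_surj phiH]] := array_bijection.
have put a (v : 'I_n -> coset_set) : exists b,
    (phi a).2 = (phi b).2 /\ forall i, (phi b).1 i = v i.
  have [b bP] := phi_surj ([ffun i => v i], (phi a).2).
  by exists b; rewrite bP; split=> // i; rewrite ffunE.
have ext a b : (phi a).2 = (phi b).2 ->
    (forall i, (phi a).1 i = (phi b).1 i) -> a = b.
  move=> E2 E1; apply: phi_inj; rewrite [LHS]surjective_pairing.
  by rewrite [RHS]surjective_pairing E2; congr pair; apply/ffunP.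
exists (@Lensop _ _ _ n (fun i => (w i, fun a => (phi a).1 i))
  (fun a b => (phi a).2 = (phi b).2) w_div (fun a => erefl)
  (fun a b => @esym _ _ _) (fun b a c => @etrans _ _ _ _) put ext) => h hH.
have phiV a : phi a = array_act h (phi (coset_act h^-1 a)).
  by rewrite -phiH // -coset_actM mulgV coset_act1.
apply: lensop_eq => [i|a b] /=.
  rewrite wH //; congr pair; apply: funext => a.
  by rewrite [in RHS]phiV ffunE.
rewrite [X in _ <-> X.2 = _]phiV [X in _ <-> _ = X.2]phiV /=; split=> [->//|].
by move/(can_inj (act_invK coset_act1 coset_actM h)).
Qed.

End Words.
End Lenses.
End PermutationActions.
End CosetSets.

Section CosetNumbering.
Local Open Scope group_scope.
Variables (gT : finGroupType) (K H : {group gT}).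

Lemma coset_numbering_exists : K \subset H ->
  exists (s : {morphism H >-> 'S_#|H : K|}) (b : 'I_#|H : K| -> {set gT}),
    [/\ injective b, forall A, A \in lcosets K H <-> exists i, A = b i
      & forall h i, h \in H -> b (s h i) = h^-1 *: b i].
Proof.
move=> sKH; have cardE := card_lcosets H K.
pose b (i : 'I_#|H : K|) := enum_val (cast_ord (esym cardE) i).
have b_inj : injective b by move=> i j /enum_val_inj/cast_ord_inj.
have bP A : A \in lcosets K H <-> exists i, A = b i.
  split=> [AH|[i ->]]; last exact: enum_valP.
  exists (cast_ord cardE (enum_rank_in AH A)).
  by rewrite /b cast_ord_comp cast_ord_id enum_rankK_in.
have s_ex h : exists t : 'S_#|H : K|,
    h \in H -> forall i, b (t i) = h^-1 *: b i.
  have [hH|_] := boolP (h \in H); last by exists 1.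
  have f_ex i : exists j, b j = h^-1 *: b i.
    have /bP[j ->] : h^-1 *: b i \in lcosets K H; last by exists j.
    have /lcosetsP[x xH ->] : b i \in lcosets K H by apply/bP; exists i.
    by apply/lcosetsP; exists (h^-1 * x); rewrite ?lcosetM ?groupM ?groupV.
  have [f fP] := choice f_ex.
  have f_inj : injective f.
    by move=> i j /(congr1 b); rewrite !fP => /lcoset_inj/b_inj.
  by exists (perm f_inj) => _ i; rewrite permE.
have [s sP] := choice s_ex.
have sM : {in H &, {morph s : g h / g * h}}.
  move=> g h gH hH; apply/permP => i; apply: b_inj.
  by rewrite permM !sP ?groupM // invMg lcosetM.
by exists (Morphism sM), b; split=> // h i hH; exact: sP.
Qed.

End CosetNumbering.

(** * Words labelled by transfers *)

Section Letters.
Local Open Scope group_scope.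
Variables (gT : finGroupType) (T : {group gT} -> {group gT} -> Prop).

(* A letter (x K, x H, m) with K -> H is one of countably many edges leading to
   x K out of the node x H. *)
Definition letter := ({set gT} * {set gT} * nat)%type.

Definition letter_act g (l : letter) : letter := (g *: l.1.1, g *: l.1.2, l.2).

Definition edge (l : letter) : Prop :=
  exists K H x, [/\ T K H, l.1.1 = x *: K & l.1.2 = x *: H].

Definition siblings (l l' : letter) : Prop :=
  [/\ l <> l', l.1.2 = l'.1.2, edge l & edge l'].

Lemma letter_act1 l : letter_act 1 l = l.
Proof. by case: l => [[X Y] m]; rewrite /letter_act /= !lcoset1. Qed.

Lemma letter_actM g h l : letter_act (g * h) l = letter_act g (letter_act h l).
Proof. by case: l => [[X Y] m]; rewrite /letter_act /= !lcosetM. Qed.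

Lemma edge_act g l : edge l -> edge (letter_act g l).
Proof.
case=> K [H [x [TKH lK lH]]]; exists K, H, (g * x).
by rewrite /= lK lH !lcosetM.
Qed.

Lemma siblings_irr l : ~ siblings l l.
Proof. by case. Qed.

Lemma siblings_act g l l' :
  siblings l l' -> siblings (letter_act g l) (letter_act g l').
Proof.
case=> ne E el el'; split; [|by rewrite /= E|exact: edge_act|exact: edge_act].
move=> /(congr1 (letter_act g^-1)); rewrite -!letter_actM mulVg.
by rewrite !letter_act1.
Qed.

(** The separated letters cannot lie inside [v], as [siblings] is irreflexive, nor further on, as
    the words already differ at [l] and [l']. *)
Lemma diverge_first v l l' u u' : l <> l' ->
  diverge siblings (v ++ l :: u) (v ++ l' :: u') -> siblings l l'.
Proof.
move=> ne [w [m [m' [x [x' [E E' sib]]]]]].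
elim: v w E E' => [|a v IHv] [|b w] /=.
- by move=> [-> _] [-> _].
- by move=> [lb _] [l'b _]; case: ne; rewrite lb l'b.
- by move=> [am _] [am' _]; case: (@siblings_irr a); rewrite {1}am am'.
- by move=> [_ +] [_ +]; exact: IHv.
Qed.

End Letters.

(** * Transfers of the two discrete operads *)

Section Realization.
Local Open Scope group_scope.
Variables (gT : finGroupType) (gT_abelian : abelian [set: gT]).
Variable I : {group gT} -> Prop.
Hypotheses (IT : I [set: gT]%G)
  (II : forall M N, I M -> I N -> I (M :&: N)%G).
Variable T : {group gT} -> {group gT} -> Prop.
Hypothesis T_transfer : transfer_system T.
Hypothesis T_compat : forall H K L : {group gT}, K \subset H -> L \subset H ->
  T K H -> isotropy_transfer I (K :&: L)%G K -> isotropy_transfer I L H.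
Implicit Types H K L M N : {group gT}.

Local Notation A := (coset_set I).
Local Notation sib := (siblings T).

Definition O_discrete : Goperad gT :=
  injop_goperad (@coset_act1 gT I) (@coset_actM gT I).

Definition P_discrete : Goperad gT :=
  lens_goperad (@coset_act1 gT I) (@coset_actM gT I) (@letter_act1 gT)
    (@letter_actM gT) (@siblings_act gT T).

Definition pair_discrete : operad_pair P_discrete O_discrete :=
  lens_pair (@coset_act1 gT I) (@coset_actM gT I) (@letter_act1 gT)
    (@letter_actM gT) (@siblings_act gT T).

Lemma O_free n (x : O_discrete n) (s : 'S_n) : sact x s = x -> s = 1.
Proof.
move=> xs; apply/permP => i; rewrite perm1.
pose a : A := mk_coset IT 1 0.
have := congr1 (fun x : injop A n => x i a) xs.
by move/(@injopP _ _ (x : injop A n)) => [].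
Qed.

Lemma P_free n (x : P_discrete n) (s : 'S_n) : sact x s = x -> s = 1.
Proof.
move=> xs; apply/permP => i; rewrite perm1; apply: contrapT => si.
apply: (@diverge_irr _ _ (@siblings_irr gT T)
  (lens_arm (x : lensop A sib n) i).1).
have := lens_diverge (x : lensop A sib n) si.
have E : lens_arm (x : lensop A sib n) (s i) =
    lens_arm (x : lensop A sib n) i.
  exact: (congr1 (fun y : P_discrete n => arm_of y i) xs).
by rewrite E.
Qed.

Section FixedPoints.
Variables (H : {group gT}) (n : nat) (s : gT -> 'S_n).
Hypothesis sM : {in H &, {morph s : g h / g * h}}.

Lemma O_fixed_exists : admissible H s (isotropy_transfer I) ->
  exists x : O_discrete n, forall h, h \in H -> gact h (sact x (s h)) = x.
Proof. exact: (injop_fixed_exists gT_abelian). Qed.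

Lemma P_fixed_exists (c : 'I_n -> letter gT) : admissible H s T ->
  (forall i j, i <> j -> sib (c i) (c j)) ->
  (forall h i, h \in H -> letter_act h (c (s h i)) = c i) ->
  exists x : P_discrete n, forall h, h \in H -> gact h (sact x (s h)) = x.
Proof.
move=> s_adm c_sib cH.
apply: (@lensop_fixed_exists _ gT_abelian I IT II H n s sM T
   T_compat s_adm (letter gT) (@letter_act gT) sib (@siblings_act gT T)
   (fun i => [:: c i])) => [i j ij|h i hH] /=; last by rewrite cH.
by exists [::], (c i), (c j), [::], [::]; split=> //; exact: c_sib.
Qed.

End FixedPoints.

Let T_refl H : T H H. Proof. by case: T_transfer => [[]]. Qed.

Let T_sub K H : T K H -> K \subset H.
Proof. by case: T_transfer => _ + _ _; exact. Qed.

Let T_trans L K H : T L K -> T K H -> T L H.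
Proof. by case: T_transfer => [[_ _ +] _ _ _]; exact. Qed.

Let T_restrict L H K : T L H -> K \subset H -> T (K :&: L)%G K.
Proof. by case: T_transfer => _ _ + _; exact. Qed.

Lemma trivial_admissible n (S : {group gT} -> {group gT} -> Prop) :
  S [set: gT]%G [set: gT]%G ->
  admissible [set: gT]%G (fun=> 1 : 'S_n) S.
Proof.
move=> ST i; exists [set: gT]%G => // h.
by rewrite perm1 !finset.in_setT.
Qed.

Lemma O_fixed n : exists x : O_discrete n, forall g, gact g x = x.
Proof.
have [||x xP] := @O_fixed_exists [set: gT]%G n (fun=> 1).
- by move=> g h _ _; rewrite mulg1.
- apply: trivial_admissible; exists [set: gT]%G => //.
  by apply/group_inj; rewrite /= finset.setIT.
by exists x => g; rewrite -[RHS](xP g) ?finset.in_setT // sact1.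
Qed.

(** The words are single G-fixed edges from G to G, told apart only by the number in the letter. *)
Lemma P_fixed n : exists x : P_discrete n, forall g, gact g x = x.
Proof.
have [|||h i _|x xP] := @P_fixed_exists [set: gT]%G n (fun=> 1) _
  (fun i => ([set: gT], [set: gT], val i)).
- by move=> g h _ _; rewrite mulg1.
- exact: trivial_admissible (T_refl _).
- have edgeT m : edge T ([set: gT]%SET, [set: gT]%SET, m).
    by exists [set: gT]%G, [set: gT]%G, 1; rewrite /= lcoset1.
  by move=> i j ij; split=> // -[/val_inj].
- by rewrite perm1 /letter_act /= lcoset_id ?finset.in_setT.
by exists x => g; rewrite -[RHS](xP g) ?finset.in_setT // sact1.
Qed.

Lemma numbering_stab K H (s : {morphism H >-> 'S_#|H : K|})
    (b : 'I_#|H : K| -> {set gT}) :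
  injective b -> (forall A, A \in lcosets K H <-> exists i, A = b i) ->
  (forall h i, h \in H -> b (s h i) = h^-1 *: b i) ->
  K \subset H ->
  forall i h, h \in K <-> h \in H /\ s h i = i.
Proof.
move=> b_inj bP sb sKH i h.
have /lcosetsP[x xH bx] : b i \in lcosets K H by apply/bP; exists i.
have fixP : h \in H -> (s h i = i <-> h \in K).
  move=> hH; rewrite -groupV -(lcoset_fixed gT_abelian _ x) -bx -sb //.
  by split=> [->//|/eqP/b_inj].
by split=> [hK|[hH /fixP]]; last exact; have hH := fintype.subsetP sKH h hK;
  split=> //; apply/fixP.
Qed.

Lemma fixed_pointsE (X : symGspaces gT) n H (s : gT -> 'S_n) (x : X n) :
  fixed_points X [set (h, s h) | h in H]%SET x <->
  forall h, h \in H -> gact h (sact x (s h)) = x.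
Proof.
split=> [fixx h hH|fixx _ _ /imsetP[h hH [-> ->]]]; last exact: fixx.
by apply: fixx; apply/imsetP; exists h.
Qed.

(** At a G-fixed point [a], a fixed injection restricts to an equivariant injection of H / K into A,
    so [K] is the intersection of [H] with a stabilizer in A. *)
Lemma O_transfer K H :
  operad_transfer O_discrete K H <-> isotropy_transfer I K H.
Proof.
split=> [[sKH [s [b [b_inj bP sb [x /fixed_pointsE xP]]]]]|TKH].
  have KP := numbering_stab b_inj bP sb sKH.
  have /bP[i _] : (K : {set gT}) \in lcosets K H.
    by apply/lcosetsP; exists 1; rewrite ?lcoset1.
  pose a : A := mk_coset IT 1 0.
  have a_fixed h : coset_act h a = a.
    rewrite coset_act_mk; apply: mk_coset_eq => //.
    by rewrite mulg1 lcoset1 lcoset_id ?finset.in_setT.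
  pose c j := injop_app x j a.
  have cH h : h \in H -> coset_act h (c (s h i)) = c i.
    move=> hH; have := congr1 (fun x : injop A _ => x i a) (xP h hH).
    by rewrite /= a_fixed.
  have [M IM MP] := coset_stab gT_abelian (c i).
  exists M => //; apply/group_inj/setP => h; rewrite finset.in_setI.
  apply/idP/andP=> [/(KP i)[hH hi]|[hH /MP hc]].
    by split=> //; apply/MP; rewrite -{2}(cH h hH) hi.
  apply/(KP i); split=> //.
  have /(can_inj (act_invK (@coset_act1 gT I) (@coset_actM gT I) h)) :
    coset_act h (c (s h i)) = coset_act h (c i) by rewrite cH.
  by case/(@injopP _ _ (x : injop A _)).
have sKH : K \subset H by case: TKH => M _ ->; exact: subsetIl.
split=> //; have [s [b [b_inj bP sb]]] := coset_numbering_exists sKH.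
exists s, b; split=> //.
have [i|x xP] := @O_fixed_exists H _ s (@morphM _ _ _ s).
  by exists K => //; exact: (numbering_stab b_inj bP sb sKH i).
by exists x; apply/fixed_pointsE.
Qed.

(* The stabilizer in H of the word w i is computed one letter at a time: if the
   stabilizer N of a prefix moves the next letter (x K', x H', m), then it fixes
   its node x H', so N <= H' and N :&: K' -> N is a restriction of K' -> H'. *)
Lemma P_transfer_sound K H n (s : gT -> 'S_n) (x : P_discrete n) i :
  {in H &, {morph s : g h / g * h}} ->
  (forall h, h \in K <-> h \in H /\ s h i = i) ->
  (forall h, h \in H -> gact h (sact x (s h)) = x) -> T K H.
Proof.
move=> sM KP xP; pose w j := (arm_of x j).1.
have wH h j : h \in H -> map (@letter_act gT h) (w (s h j)) = w j.
  move=> hH.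
  exact: (congr1 (fun y : P_discrete n => (arm_of y j).1) (xP h hH)).
have w_inj j j' : w j = w j' -> j = j'.
  move=> E; apply: contrapT => /(lens_diverge (x : lensop A sib n)).
  by rewrite -/(w j) -/(w j') E => /(diverge_irr (@siblings_irr gT T)).
have wV h : h \in H -> map (@letter_act gT h) (w i) = w (s h^-1 i).
  by move=> hH; rewrite -[in RHS](wH h) // (perm_actVK sM).
have prefix_stab v u : w i = v ++ u -> exists2 N : {group gT}, T N H &
    forall h, h \in N <-> h \in H /\ map (@letter_act gT h) v = v.
  elim/last_ind: v u => [|v l IHv] u wi.
    by exists H => // h; split=> [|[]].
  have [|N TNH NP] := IHv (l :: u); first by rewrite wi cat_rcons.
  (* [h] carries the word of [i] to the word of another letter with the same prefix [v]; if [l]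
     moves, the two words first differ there. *)
  have Nsib h : h \in N -> letter_act h l <> l -> sib l (letter_act h l).
    move=> /NP[hH hv] hl; apply: (@diverge_first _ _ v _ _ u
      (map (@letter_act gT h) u)); first exact/nesym.
    have -> : v ++ l :: u = w i by rewrite wi cat_rcons.
    have -> : v ++ letter_act h l :: map (@letter_act gT h) u = w (s h^-1 i).
      by rewrite -wV // wi map_cat map_rcons hv cat_rcons.
    apply: lens_diverge => E; apply: hl; have := wV h hH; rewrite -E wi.
    rewrite map_cat map_rcons hv !cat_rcons => /eqP.
    by rewrite eqseq_cat // eqxx /= => /eqP[].
  have mapE h : map (@letter_act gT h) (rcons v l) = rcons v l <->
      map (@letter_act gT h) v = v /\ letter_act h l = l.
    rewrite map_rcons; split=> [/rcons_inj[-> ->] //|[-> ->] //].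
  have [fixl|/existsNP[h0 /not_implyP[h0N h0l]]] :=
    pselect (forall h, h \in N -> letter_act h l = l).
    exists N => // h; split=> [hN|[hH /mapE[hv _]]]; last exact/NP.
    by have /NP[hH hv] := hN; split=> //; apply/mapE; rewrite fixl.
  have [_ _ [K' [H' [y [TKH' lK lH]]]] _] := Nsib h0 h0N h0l.
  have sNH' : N \subset H'.
    apply/fintype.subsetP => h hN; rewrite -(lcoset_fixed gT_abelian h y) -lH.
    (* An unmoved letter keeps its node, and a moved one becomes a sibling with the same node. *)
    have [hl|hl] := pselect (letter_act h l = l); first by rewrite -{2}hl.
    have [_ lhl _ _] := Nsib h hN hl.
    by rewrite -[h *: _]/((letter_act h l).1.2) -lhl.
  exists (N :&: K')%G; first exact: T_trans (T_restrict TKH' sNH') TNH.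
  move=> h; rewrite finset.in_setI; split=> [/andP[hN hK]|[hH /mapE[hv hl]]].
    have /NP[hH hv] := hN; split=> //; apply/mapE; split=> //.
    rewrite /letter_act lK lH; case: (l) lK lH => [[X Y] m] /= -> ->.
    congr (_, _, _); apply/eqP; rewrite lcoset_fixed //.
    exact: (fintype.subsetP sNH').
  apply/andP; split; first exact/NP.
  by rewrite -(lcoset_fixed gT_abelian h y) -lK -{2}hl.
have [|N TNH NP] := prefix_stab (w i) [::]; first by rewrite cats0.
(* Distinct letters have distinct words, so fixing the whole word of [i] means fixing [i]. *)
suff -> : K = N by [].
apply/group_inj/setP => h; apply/idP/idP => [/KP[hH hi]|/NP[hH]].
  by apply/NP; split=> //; rewrite wV // -[in LHS]hi (perm_actK sM).
rewrite wV // => /w_inj hi; apply/KP; split=> //.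
by rewrite -[in LHS]hi (perm_actVK sM).
Qed.

(** To realize a transfer, the words are the single edges from the node [H] to the cosets of [K],
    which [H] permutes as H / K. *)
Lemma P_transfer K H : operad_transfer P_discrete K H <-> T K H.
Proof.
split=> [[sKH [s [b [b_inj bP sb [x /fixed_pointsE xP]]]]]|TKH].
  have /bP[i _] : (K : {set gT}) \in lcosets K H.
    by apply/lcosetsP; exists 1; rewrite ?lcoset1.
  apply: P_transfer_sound (@morphM _ _ _ s) _ xP.
  exact: (numbering_stab b_inj bP sb sKH i).
have sKH := T_sub TKH.
split=> //; have [s [b [b_inj bP sb]]] := coset_numbering_exists sKH.
exists s, b; split=> //.
have [i|i j ij|h i hH|x xP] := @P_fixed_exists H _ s (@morphM _ _ _ s)
  (fun i => (b i, H : {set gT}, 0%N)).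
- by exists K => //; exact: (numbering_stab b_inj bP sb sKH i).
- have b_edge m : edge T (b m, H : {set gT}, 0%N).
    have /lcosetsP[y yH ->] : b m \in lcosets K H by apply/bP; exists m.
    by exists K, H, y; split=> //=; rewrite lcoset_id.
  by split=> // -[/b_inj].
- by rewrite /letter_act /= sb // lcosetKV lcoset_id.
by exists x; apply/fixed_pointsE.
Qed.

End Realization.

Theorem theorem3 (R : realType) (gT : finGroupType)
    (gT_abelian : abelian [set: gT])
    (T : {group gT} -> {group gT} -> Prop) (T_transfer : transfer_system T)
    (U : orthRep R gT) (U_universe : universe U)
    (TU_compatible : compatible T (discs_transfer U)) :
  exists (P O : Goperad gT) (_ : operad_pair P O),
    [/\ Ninfty_operad R P, Ninfty_operad R O,
        forall K H, operad_transfer P K H <-> T K H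
      & forall K H, operad_transfer O K H <-> discs_transfer U K H].
Proof.
pose I := isotropy U; have IT : I [set: gT]%G := isotropyT U.
have II M N : I M -> I N -> I (M :&: N)%G by exact: isotropyI.
have T_compat (H K L : {group gT}) : K \subset H -> L \subset H -> T K H ->
    isotropy_transfer I (K :&: L)%G K -> isotropy_transfer I L H.
  move=> sKH sLH TKH /discs_transferP TKL; apply/discs_transferP.
  exact: TU_compatible TKL.
exists (step_goperad R (P_discrete I T)), (step_goperad R (O_discrete I)).
exists (step_pair R (pair_discrete I T)); split.
- by apply: step_Ninfty; [exact: P_free|exact: P_fixed].
- by apply: step_Ninfty; [exact: O_free|exact: O_fixed].
- move=> K H; have stepE := step_operad_transfer R (P_discrete I T) K H.
  have discE := P_transfer gT_abelian IT II T_transfer T_compat K H.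
  exact: iff_trans stepE discE.
move=> K H; have stepE := step_operad_transfer R (O_discrete I) K H.
have discE := O_transfer gT_abelian IT II K H.
exact: iff_trans stepE (iff_trans discE (iff_sym (discs_transferP U K H))).
Qed.
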